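(* Let $m$ be a positive integer and $-\frac\pi2<x<\frac\pi2$. Then $$\sum_{n=1}^\infty\frac{(-1)^{n-1}\cos(2n-1)x}{(2n-1)^{2m}}=\frac{(-1)^{m-1}(2\pi)^{2m-1}}{2(2m-1)!}\Big(\zeta'\Big(1-2m,\tfrac14-\tfrac x{2\pi}\Big)-\zeta'\Big(1-2m,\tfrac34-\tfrac x{2\pi}\Big)+\zeta'\Big(1-2m,\tfrac14+\tfrac x{2\pi}\Big)-\zeta'\Big(1-2m,\tfrac34+\tfrac x{2\pi}\Big)\Big).$$
   Context: For $0<a\le 1$ (more generally $a>0$), $\zeta(s,a)$ denotes the Hurwitz zeta function, defined for $\Re s>1$ by $\zeta(s,a)=\sum_{k=0}^\infty (k+a)^{-s}$ and extended by analytic continuation to all complex $s\neq 1$. Throughout, $\zeta'(s,a)$ denotes the partial derivative $\frac{\partial}{\partial s}\zeta(s,a)$ with respect to the first variable $s$. *)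

(* Defs.v *)
From Stdlib Require Import Reals Arith Factorial.
From Coquelicot Require Import Coquelicot.
Open Scope R_scope.

Definition real_analytic (g : R -> R) : Prop :=
  forall x0 : R, exists (c : nat -> R) (r : R), 0 < r /\
    forall x : R, Rabs (x - x0) < r -> is_pseries c (x - x0) (g x).

(* [Z] is (the restriction to real s of) the Hurwitz zeta function:
   for every a > 0,
   - for s > 1, Z s a = sum_{k>=0} (k+a)^(-s);
   - s |-> (s-1) Z s a coincides (for s <> 1) with a real-analytic function on R,
     i.e. s |-> Z s a is the analytic continuation, with a simple pole at s = 1.
   By the identity theorem (R is connected) these properties determine Z s a for
   all real s <> 1, and it agrees with the restriction of the complex-analytic
   continuation of the Hurwitz zeta function. *)
Definition is_HurwitzZeta (Z : R -> R -> R) : Prop :=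
  forall a : R, 0 < a ->
    (forall s : R, 1 < s ->
       is_series (fun k : nat => Rpower (INR k + a) (- s)) (Z s a)) /\
    (exists g : R -> R, real_analytic g /\
       forall s : R, s <> 1 -> g s = (s - 1) * Z s a).

(* Main.v *)
Require Import Defs.
From Stdlib Require Import Reals Arith Factorial Lra Lia ClassicalEpsilon Classical_Prop.
From Coquelicot Require Import Coquelicot.
Open Scope R_scope.

(** Let [D_m a] be the derivative at [s = 1 - 2m] of [Z s a - Z s (1 - a)].
    For [s > 1] and [0 < a < 1], [Z s a - Z s (1 - a)] is [a^(-s)] plus an odd power series in [a]
    whose coefficients are Pochhammer symbols times values [Z (s + j) 1]; a majorant argument shows
    that the tail of this series is real-analytic in [s], so the expansion persists near [1 - 2m] by
    the identity theorem.  Differentiating in [s] writes [D_m] as a power series minus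
    [a^(2m-1) * ln a], whence [D_m'' = (2m-1)(2m-2) D_(m-1)] for [m >= 2], while
    [D_1'' a = - PI * cot (PI * a)] is the partial fraction expansion of the cotangent.
    With [a = 1/4 -+ x/(2 PI)] the sum of the two [D_m], suitably scaled, has the same second derivative in [x]
    as the trigonometric series (for [m = 1] the twice differentiated series is Cesaro summable to
    [1 / (2 cos x)]); the difference is even, affine, and tends to [0] as [x -> PI/2]. *)

(** * Interchange of double series *)

(* [ring] and [field] do not see through the canonical structures carried by Coquelicot's equations. *)
Ltac eqR := match goal with |- @eq _ ?x ?y => change (@eq R x y) end.

(** The difference [Z s a - Z s (1 - a)] is forced by a pole: the Taylor coefficient of index 2m of
    [Z s (1 + a)] multiplies the pole of zeta at 1 by a Pochhammer symbol vanishing at s = 1 - 2m,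
    and this indeterminate product would have to be differentiated. In the difference all even
    indices cancel. Continuation takes place along the real line only, through local power series.
    Infinitely many Taylor terms must then share one radius of convergence, so the proof carries
    norms of coefficients and not mere analyticity. Termwise differentiation of an infinite sum is
    avoided twice. In s, the tail carries a factor vanishing at 1 - 2m, so its derivative there is
    just a value. In x, mean value estimates on partial sums, or on their averages, replace
    convergence of derivatives. No constant of integration has to be evaluated: as x tends to pi/2
    the two parameters tend to 0 and 1/2, where [D_m] tends to 0 (at 1/2 by antisymmetry), and every
    cosine of the series vanishes at pi/2. *)

Lemma is_series_eq (a b : nat -> R) (la lb : R) :
  (forall n, a n = b n) -> la = lb -> is_series a la -> is_series b lb.
Proof. intros E <- H. exact (is_series_ext a b la E H). Qed.

Lemma is_series_zero : is_series (fun _ : nat => 0) 0.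
Proof.
  change (is_lim_seq (sum_n (fun _ : nat => 0)) 0).
  apply (is_lim_seq_ext (fun _ => 0)); [|apply is_lim_seq_const].
  intros n. rewrite sum_n_const. ring.
Qed.

Lemma is_series_Rmult (k : R) (a : nat -> R) (l : R) :
  is_series a l -> is_series (fun n => k * a n) (k * l).
Proof. exact (is_series_scal k a l). Qed.

Lemma Rabs_sum_n_le (u v : nat -> R) (n : nat) :
  (forall k, Rabs (u k) <= v k) -> Rabs (sum_n u n) <= sum_n v n.
Proof.
  intros H. induction n as [|n IH].
  - rewrite !sum_O. apply H.
  - rewrite !sum_Sn. unfold plus; simpl.
    eapply Rle_trans; [apply Rabs_triang|]. specialize (H (S n)). lra.
Qed.

Lemma sum_n_le_Series (u : nat -> R) (n : nat) :
  (forall k, 0 <= u k) -> ex_series u -> sum_n u n <= Series u.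
Proof.
  intros H0 He.
  apply (is_lim_seq_incr_compare (sum_n u) (Series u)).
  - apply Series_correct, He.
  - intros k. rewrite sum_Sn. unfold plus; simpl. specialize (H0 (S k)). lra.
Qed.

Lemma term_le_Series (u : nat -> R) (n : nat) :
  (forall k, 0 <= u k) -> ex_series u -> u n <= Series u.
Proof.
  intros H0 He. eapply Rle_trans; [|apply (sum_n_le_Series u n H0 He)].
  destruct n as [|n].
  - rewrite sum_O. lra.
  - rewrite sum_Sn. unfold plus; simpl.
    assert (0 <= sum_n u n).
    { clear He. induction n as [|n IH]; [rewrite sum_O; apply H0|].
      rewrite sum_Sn. unfold plus; simpl. specialize (H0 (S n)). lra. }
    lra.
Qed.

Lemma ex_series_Rabs_le (u v : nat -> R) :
  (forall k, Rabs (u k) <= v k) -> ex_series v -> ex_series u.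
Proof. intros H Hv. exact (ex_series_le u v H Hv). Qed.

Lemma is_lim_seq_sum_n_zero (w : nat -> nat -> R) (K : nat) :
  (forall k, is_lim_seq (fun n => w n k) 0) -> is_lim_seq (fun n => sum_n (w n) K) 0.
Proof.
  intros H. induction K as [|K IH].
  - apply is_lim_seq_ext with (fun n => w n O); [intros; now rewrite sum_O|apply H].
  - apply is_lim_seq_ext with (fun n => sum_n (w n) K + w n (S K)).
    + intros n. now rewrite sum_Sn.
    + replace 0 with (0 + 0) by ring. now apply (is_lim_seq_plus' _ _ 0 0).
Qed.

(** Tannery's theorem. Cut at an index K beyond which the tail of [M] is below eps/4: the head is a
    finite sum and is eventually below eps/4, and the tail is at most twice that of [M]. *)
Lemma Series_dominated_convergence (u : nat -> nat -> R) (v M : nat -> R) :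
  (forall k, is_lim_seq (fun n => u n k) (v k)) ->
  (forall n k, Rabs (u n k) <= M k) -> ex_series M ->
  is_lim_seq (fun n => Series (u n)) (Series v).
Proof.
  intros Hu HM eM.
  assert (M0 : forall k, 0 <= M k)
    by (intros k; eapply Rle_trans; [apply Rabs_pos|apply (HM O k)]).
  assert (Hv : forall k, Rabs (v k) <= M k).
  { intros k. apply (is_lim_seq_le (fun n => Rabs (u n k)) (fun _ => M k) (Rabs (v k)) (M k)).
    - intros n; apply HM.
    - apply (is_lim_seq_abs _ (v k)), Hu.
    - apply is_lim_seq_const. }
  assert (ev : ex_series v) by (apply ex_series_Rabs_le with M; auto).
  assert (eu : forall n, ex_series (u n)) by (intros n; apply ex_series_Rabs_le with M; auto).
  assert (ew : forall n, ex_series (fun k => Rabs (u n k - v k))).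
  { intros n. apply ex_series_Rabs_le with (fun k => 2 * M k).
    - intros k. rewrite Rabs_Rabsolu. unfold Rminus.
      eapply Rle_trans; [apply Rabs_triang|]. rewrite Rabs_Ropp.
      specialize (HM n k); specialize (Hv k); lra.
    - exact (ex_series_scal 2 M eM). }
  apply is_lim_seq_spec. intros eps.
  pose proof (Series_correct _ eM) as HS.
  apply (is_lim_seq_spec (sum_n M) (Series M)) in HS.
  assert (He4 : 0 < eps / 4) by (pose proof (cond_pos eps); lra).
  destruct (HS (mkposreal _ He4)) as [K HK]. specialize (HK K (Nat.le_refl K)). simpl in HK.
  pose proof (is_lim_seq_sum_n_zero (fun n k => Rabs (u n k - v k)) K) as Hz.
  assert (Hz' : is_lim_seq (fun n => sum_n (fun k => Rabs (u n k - v k)) K) 0).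
  { apply Hz. intros k.
    replace (Finite 0) with (Rbar_abs (Finite 0)) by (simpl; now rewrite Rabs_R0).
    apply (is_lim_seq_abs _ (Finite 0)).
    replace 0 with (v k - v k) by ring.
    apply (is_lim_seq_minus' _ _ (v k) (v k)); [apply Hu|apply is_lim_seq_const]. }
  apply is_lim_seq_spec in Hz'. destruct (Hz' (mkposreal _ He4)) as [n0 Hn0].
  exists n0. intros n Hn. specialize (Hn0 n Hn). simpl in Hn0.
  rewrite <- Series_minus by auto.
  eapply Rle_lt_trans; [apply Series_Rabs, ew|].
  rewrite (Series_incr_n _ (S K)) by (auto; lia).
  rewrite (Series_incr_n M (S K)) in HK by (auto; lia).
  simpl pred in *. rewrite <- !sum_n_Reals in *.
  rewrite Rminus_0_r in Hn0. apply Rabs_def2 in Hn0.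
  apply Rabs_def2 in HK.
  assert (Series (fun k => Rabs (u n (S K + k)%nat - v (S K + k)%nat))
          <= Series (fun k => 2 * M (S K + k)%nat)).
  { apply Series_le.
    - intros k. split; [apply Rabs_pos|]. unfold Rminus.
      eapply Rle_trans; [apply Rabs_triang|]. rewrite Rabs_Ropp.
      pose proof (HM n (S K + k)%nat); pose proof (Hv (S K + k)%nat); lra.
    - apply (ex_series_scal 2 (fun k => M (S K + k)%nat)).
      now apply ex_series_incr_n. }
  rewrite Series_scal_l in H. lra.
Qed.

Lemma Series_sum_n (c : nat -> nat -> R) (n : nat) :
  (forall i, ex_series (fun k => c k i)) ->
  ex_series (fun k => sum_n (c k) n) /\
  Series (fun k => sum_n (c k) n) = sum_n (fun i => Series (fun k => c k i)) n.
Proof.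
  intros H. induction n as [|n [IH1 IH2]].
  - rewrite sum_O. split.
    + apply ex_series_ext with (fun k => c k O); [intros; now rewrite sum_O|apply H].
    + apply Series_ext; intros; now rewrite sum_O.
  - rewrite sum_Sn, <- IH2. split.
    + apply ex_series_ext with (fun k => plus (sum_n (c k) n) (c k (S n)));
        [intros; now rewrite sum_Sn|].
      now apply (ex_series_plus (fun k => sum_n (c k) n)).
    + unfold plus at 1; simpl. rewrite <- Series_plus by auto.
      apply Series_ext; intros; now rewrite sum_Sn.
Qed.

Lemma series_swap_column (c : nat -> nat -> R) (M : nat -> R)
  (Hc : forall k, ex_series (fun i => Rabs (c k i)))
  (HM : forall k, Series (fun i => Rabs (c k i)) <= M k) (eM : ex_series M) (i : nat) : ex_series (fun k => Rabs (c k i)).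
Proof.
  apply ex_series_Rabs_le with M; [|exact eM].
  intros k. rewrite Rabs_Rabsolu. eapply Rle_trans; [|apply HM].
  apply (term_le_Series (fun i => Rabs (c k i))); [intros; apply Rabs_pos|apply Hc].
Qed.

(** Fubini as a case of dominated convergence: a partial sum over i is the series over k of partial
    row sums, and each of these is bounded by [M k]. *)
Lemma series_swap (c : nat -> nat -> R) (M : nat -> R)
  (Hc : forall k, ex_series (fun i => Rabs (c k i)))
  (HM : forall k, Series (fun i => Rabs (c k i)) <= M k) (eM : ex_series M) :
  is_series (fun i => Series (fun k => c k i)) (Series (fun k => Series (c k))).
Proof.
  assert (Hcol : forall i, ex_series (fun k => c k i))
    by (intros; apply ex_series_Rabs, (series_swap_column c M Hc HM eM)).
  change (is_lim_seq (sum_n (fun i => Series (fun k => c k i))) (Series (fun k => Series (c k)))).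
  apply is_lim_seq_ext with (fun n => Series (fun k => sum_n (c k) n)).
  { intros n. now apply Series_sum_n. }
  apply (Series_dominated_convergence (fun n k => sum_n (c k) n) _ M).
  - intros k. apply (Series_correct (c k)), ex_series_Rabs, Hc.
  - intros n k. eapply Rle_trans; [apply (Rabs_sum_n_le _ (fun i => Rabs (c k i)))|].
    + intros; apply Rle_refl.
    + eapply Rle_trans; [|apply HM].
      apply sum_n_le_Series; [intros; apply Rabs_pos|apply Hc].
  - exact eM.
Qed.

(** Supplies the norm bound for a sum of power series, whose coefficients are column sums. *)
Lemma series_swap_Rabs (c : nat -> nat -> R) (M : nat -> R)
  (Hc : forall k, ex_series (fun i => Rabs (c k i)))
  (HM : forall k, Series (fun i => Rabs (c k i)) <= M k) (eM : ex_series M) :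
  ex_series (fun i => Rabs (Series (fun k => c k i))) /\
  Series (fun i => Rabs (Series (fun k => c k i))) <= Series M.
Proof.
  assert (Hc' : forall k, ex_series (fun i => Rabs (Rabs (c k i)))).
  { intros k. apply ex_series_ext with (fun i => Rabs (c k i)); [|apply Hc].
    intros; now rewrite Rabs_Rabsolu. }
  assert (HM' : forall k, Series (fun i => Rabs (Rabs (c k i))) <= M k).
  { intros k. rewrite (Series_ext _ (fun i => Rabs (c k i))); [apply HM|].
    intros; now rewrite Rabs_Rabsolu. }
  pose proof (series_swap (fun k i => Rabs (c k i)) M Hc' HM' eM) as HS.
  assert (Hle : forall i, Rabs (Series (fun k => c k i)) <= Series (fun k => Rabs (c k i)))
    by (intros i; apply Series_Rabs, (series_swap_column c M Hc HM eM)).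
  split.
  - apply ex_series_Rabs_le with (fun i => Series (fun k => Rabs (c k i))).
    + intros i. rewrite Rabs_Rabsolu. apply Hle.
    + eexists; exact HS.
  - eapply Rle_trans.
    + apply (Series_le _ (fun i => Series (fun k => Rabs (c k i)))).
      * intros i. split; [apply Rabs_pos|apply Hle].
      * eexists; exact HS.
    + rewrite (is_series_unique _ _ HS). apply Series_le; [|exact eM].
      intros k; split; [|apply HM].
      eapply Rle_trans; [apply Rabs_pos|].
      apply (term_le_Series (fun i => Rabs (c k i)) O); [intros; apply Rabs_pos|apply Hc].
Qed.

(** * Power series with majorants and the identity theorem *)

(** The sum of [Rabs (c i) * r ^ i] is a weighted l1 norm of the coefficients on a disk of fixed
    radius. Plain analyticity would let the radius shrink from term to term and would not survive an
    infinite sum. *)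
Definition majorized (f : R -> R) (s0 r M : R) : Prop :=
  exists c : nat -> R,
    ex_series (fun i => Rabs (c i) * r ^ i) /\
    Series (fun i => Rabs (c i) * r ^ i) <= M /\
    forall h, Rabs h <= r -> is_series (fun i => c i * h ^ i) (f (s0 + h)).

(** The pointwise form of [real_analytic], which unfolds to it at every point. It is needed because
    the Taylor tail is shown analytic only on a half-line. *)
Definition analytic_at (f : R -> R) (x0 : R) : Prop :=
  exists (c : nat -> R) (r : R), 0 < r /\
    forall x, Rabs (x - x0) < r -> is_pseries c (x - x0) (f x).

Lemma is_pseries_series (c : nat -> R) (x l : R) :
  is_pseries c x l <-> is_series (fun i => c i * x ^ i) l.
Proof.
  assert (E : forall i, scal (pow_n x i) (c i) = c i * x ^ i).
  { intros i. rewrite pow_n_pow. unfold scal; simpl; unfold mult; simpl. ring. }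
  split; apply is_series_ext; intros i; [|symmetry]; apply E.
Qed.

Lemma majorized_analytic (f : R -> R) (s0 r M : R) :
  0 < r -> majorized f s0 r M -> analytic_at f s0.
Proof.
  intros Hr (c & _ & _ & H). exists c, r. split; [exact Hr|].
  intros x Hx. apply is_pseries_series.
  replace (f x) with (f (s0 + (x - s0))) by (f_equal; ring). apply H; lra.
Qed.

Lemma majorized_ext (f g : R -> R) (s0 r M : R) :
  (forall h, Rabs h <= r -> f (s0 + h) = g (s0 + h)) ->
  majorized f s0 r M -> majorized g s0 r M.
Proof.
  intros E (c & H1 & H2 & H3). exists c. repeat split; auto.
  intros h Hh. rewrite <- E by exact Hh. auto.
Qed.

Lemma majorized_le (f : R -> R) (s0 r M M' : R) :
  M <= M' -> majorized f s0 r M -> majorized f s0 r M'.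
Proof. intros E (c & H1 & H2 & H3). exists c. repeat split; auto. lra. Qed.

Lemma majorized_bound (f : R -> R) (s0 r M : R) :
  0 <= r -> majorized f s0 r M -> Rabs (f s0) <= M.
Proof.
  intros Hr (c & H1 & H2 & H3).
  assert (E : f s0 = c O).
  { rewrite <- (Rplus_0_r s0), <- (is_series_unique _ _ (H3 0 ltac:(now rewrite Rabs_R0))).
    apply is_series_unique. exact (proj1 (is_pseries_series c 0 (c O)) (is_pseries_0 c)). }
  rewrite E. eapply Rle_trans; [|exact H2].
  rewrite <- (Rmult_1_r (Rabs (c O))). apply (term_le_Series (fun i => Rabs (c i) * r ^ i) O); [|exact H1].
  intros i. apply Rmult_le_pos; [apply Rabs_pos|now apply pow_le].
Qed.

Lemma majorized_scal (f : R -> R) (s0 r M k : R) :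
  majorized f s0 r M -> majorized (fun s => k * f s) s0 r (Rabs k * M).
Proof.
  intros (c & H1 & H2 & H3). exists (fun i => k * c i).
  assert (E : forall i, Rabs k * (Rabs (c i) * r ^ i) = Rabs (k * c i) * r ^ i)
    by (intros i; rewrite Rabs_mult; ring).
  split; [|split].
  - apply ex_series_ext with (fun i => Rabs k * (Rabs (c i) * r ^ i)); [exact E|].
    exact (ex_series_scal (Rabs k) _ H1).
  - rewrite <- (Series_ext _ _ E), Series_scal_l.
    apply Rmult_le_compat_l; [apply Rabs_pos|exact H2].
  - intros h Hh. apply is_series_ext with (fun i => k * (c i * h ^ i)); [intros; apply eq_sym, Rmult_assoc|].
    now apply is_series_Rmult, H3.
Qed.

Lemma is_series_shift_mul (c : nat -> R) (h l : R) :
  is_series (fun i => c i * h ^ i) l ->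
  is_series (fun i => match i with O => 0 | S j => c j end * h ^ i) (h * l).
Proof.
  intros H. apply is_series_decr_1.
  apply is_series_ext with (fun i => h * (c i * h ^ i)).
  - intros i. simpl. ring.
  - match goal with |- is_series _ ?L => replace L with (h * l) end.
    + now apply is_series_Rmult.
    + unfold plus, opp; simpl; ring.
Qed.

(** At s = s0 + h the factor is (s0 + t) + h, and multiplication by h shifts the coefficients and
    multiplies the norm by [r]. *)
Lemma majorized_mul_linear (f : R -> R) (s0 r M t : R) :
  0 <= r -> majorized f s0 r M ->
  majorized (fun s => (s + t) * f s) s0 r ((Rabs (s0 + t) + r) * M).
Proof.
  intros Hr (c & H1 & H2 & H3).
  set (d := fun i => match i with O => 0 | S j => c j end).
  exists (fun i => (s0 + t) * c i + d i).
  assert (Hd : is_series (fun i => Rabs (d i) * r ^ i) (r * Series (fun i => Rabs (c i) * r ^ i))).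
  { apply is_series_ext with
      (fun i => match i with O => 0 | S j => Rabs (c j) end * r ^ i).
    - intros [|i]; simpl; [rewrite Rabs_R0|]; reflexivity.
    - apply (is_series_shift_mul (fun i => Rabs (c i))), Series_correct, H1. }
  assert (Hs : is_series (fun i => Rabs (s0 + t) * (Rabs (c i) * r ^ i) + Rabs (d i) * r ^ i)
     (Rabs (s0 + t) * Series (fun i => Rabs (c i) * r ^ i) + r * Series (fun i => Rabs (c i) * r ^ i))).
  { apply (is_series_plus (fun i => Rabs (s0 + t) * (Rabs (c i) * r ^ i))); [|exact Hd].
    apply is_series_Rmult, Series_correct, H1. }
  assert (Hle : forall i, 0 <= Rabs ((s0 + t) * c i + d i) * r ^ i <=
     Rabs (s0 + t) * (Rabs (c i) * r ^ i) + Rabs (d i) * r ^ i).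
  { intros i. pose proof (pow_le r i Hr). split.
    - apply Rmult_le_pos; [apply Rabs_pos|assumption].
    - rewrite <- Rmult_assoc, <- Rabs_mult, <- Rmult_plus_distr_r.
      apply Rmult_le_compat_r; [assumption|apply Rabs_triang]. }
  split; [|split].
  - apply ex_series_Rabs_le with (2 := ex_intro _ _ Hs).
    intros i. rewrite Rabs_pos_eq; apply Hle.
  - eapply Rle_trans; [apply Series_le with (2 := ex_intro _ _ Hs); exact Hle|].
    rewrite (is_series_unique _ _ Hs), <- Rmult_plus_distr_r.
    apply Rmult_le_compat_l; [pose proof (Rabs_pos (s0 + t)); lra|exact H2].
  - intros h Hh.
    apply (is_series_eq (fun i => (s0 + t) * (c i * h ^ i) + d i * h ^ i) _
             ((s0 + t) * f (s0 + h) + h * f (s0 + h))); [intros i; ring|ring|].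
    apply (is_series_plus (fun i => (s0 + t) * (c i * h ^ i))).
    + now apply is_series_Rmult, H3.
    + apply is_series_shift_mul, H3, Hh.
Qed.

Lemma is_series_exp (x : R) : is_series (fun i => / INR (fact i) * x ^ i) (exp x).
Proof. exact (proj1 (is_pseries_series _ _ _) (is_exp_Reals x)). Qed.

Lemma is_series_Rpower (y s0 h : R) :
  is_series (fun i => Rpower y (- s0) * (/ INR (fact i) * (- ln y) ^ i) * h ^ i)
    (Rpower y (- (s0 + h))).
Proof.
  apply (is_series_eq (fun i => Rpower y (- s0) * (/ INR (fact i) * (- ln y * h) ^ i)) _
           (Rpower y (- s0) * exp (- ln y * h))).
  - intros i. rewrite Rpow_mult_distr. ring.
  - unfold Rpower. rewrite <- exp_plus. f_equal. ring.
  - apply is_series_Rmult, is_series_exp.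
Qed.

Lemma analytic_at_Rpower (y s0 : R) : analytic_at (fun s => Rpower y (- s)) s0.
Proof.
  exists (fun i => Rpower y (- s0) * (/ INR (fact i) * (- ln y) ^ i)), 1.
  split; [lra|]. intros s _. apply is_pseries_series.
  replace (Rpower y (- s)) with (Rpower y (- (s0 + (s - s0)))) by (do 2 f_equal; ring).
  apply is_series_Rpower.
Qed.

(** Since [ln y >= 0], the absolute values of the coefficients in h are those of the same
    exponential with h replaced by -h. The norm is therefore the value at the left end s0 - r of the
    disk. *)
Lemma majorized_Rpower (y t s0 r : R) :
  1 <= y -> 0 <= r ->
  majorized (fun s => Rpower y (- (s + t))) s0 r (Rpower y (- (s0 + t - r))).
Proof.
  intros Hy Hr.
  assert (Hl : 0 <= ln y) by (rewrite <- ln_1; destruct Hy as [Hy| <-]; [left; apply ln_increasing; lra|lra]).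
  exists (fun i => Rpower y (- (s0 + t)) * (/ INR (fact i) * (- ln y) ^ i)).
  assert (Hs : is_series (fun i => Rpower y (- (s0 + t)) * (/ INR (fact i) * (ln y * r) ^ i))
     (Rpower y (- (s0 + t - r)))).
  { replace (Rpower y (- (s0 + t - r))) with (Rpower y (- (s0 + t)) * exp (ln y * r)).
    - apply is_series_Rmult, is_series_exp.
    - unfold Rpower. rewrite <- exp_plus. f_equal. ring. }
  assert (E : forall i, Rpower y (- (s0 + t)) * (/ INR (fact i) * (ln y * r) ^ i) =
     Rabs (Rpower y (- (s0 + t)) * (/ INR (fact i) * (- ln y) ^ i)) * r ^ i).
  { intros i. rewrite !Rabs_mult, <- RPow_abs, Rabs_Ropp, (Rabs_pos_eq (ln y)) by exact Hl.
    rewrite (Rabs_pos_eq (Rpower _ _)) by (left; apply exp_pos).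
    rewrite (Rabs_pos_eq (/ _)) by (left; apply Rinv_0_lt_compat, INR_fact_lt_0).
    rewrite Rpow_mult_distr. ring. }
  split; [|split].
  - eexists. exact (is_series_ext _ _ _ E Hs).
  - rewrite <- (Series_ext _ _ E), (is_series_unique _ _ Hs). lra.
  - intros h _. replace (s0 + h + t) with (s0 + t + h) by ring. apply is_series_Rpower.
Qed.

(** A Weierstrass theorem on a fixed disk. Choice picks one coefficient sequence per function; the
    coefficients of the sum are the column sums, and both the expansion and its norm bound are
    exchanges of double series. *)
Lemma majorized_Series (f : nat -> R -> R) (s0 r : R) (M : nat -> R) :
  0 < r -> (forall k, majorized (f k) s0 r (M k)) -> ex_series M ->
  majorized (fun s => Series (fun k => f k s)) s0 r (Series M).
Proof.
  intros Hr Hf eM.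
  set (c := fun k => proj1_sig (constructive_indefinite_description _ (Hf k))).
  assert (Hc := fun k => proj2_sig (constructive_indefinite_description _ (Hf k))).
  change (forall k, ex_series (fun i => Rabs (c k i) * r ^ i) /\
    Series (fun i => Rabs (c k i) * r ^ i) <= M k /\
    forall h, Rabs h <= r -> is_series (fun i => c k i * h ^ i) (f k (s0 + h))) in Hc.
  clearbody c.
  assert (Rpos : forall i, 0 < r ^ i) by (intros; now apply pow_lt).
  assert (Ha : forall x k, Rabs x <= r -> ex_series (fun i => Rabs (c k i * x ^ i)) /\
     Series (fun i => Rabs (c k i * x ^ i)) <= M k).
  { intros x k Hx. destruct (Hc k) as (H1 & H2 & _).
    assert (Hle : forall i, 0 <= Rabs (c k i * x ^ i) <= Rabs (c k i) * r ^ i).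
    { intros i. split; [apply Rabs_pos|]. rewrite Rabs_mult, <- RPow_abs.
      apply Rmult_le_compat_l; [apply Rabs_pos|]. apply pow_incr. split; [apply Rabs_pos|exact Hx]. }
    split.
    - apply ex_series_Rabs_le with (2 := H1). intros i; rewrite Rabs_Rabsolu; apply Hle.
    - eapply Rle_trans; [|exact H2]. now apply Series_le. }
  assert (Rr : Rabs r <= r) by (rewrite Rabs_pos_eq; lra).
  destruct (series_swap_Rabs (fun k i => c k i * r ^ i) M) as [S1 S2];
    [intros k; apply Ha, Rr|intros k; apply Ha, Rr|exact eM|].
  assert (E : forall i, Rabs (Series (fun k => c k i * r ^ i)) =
                        Rabs (Series (fun k => c k i)) * r ^ i).
  { intros i. rewrite Series_scal_r, Rabs_mult, (Rabs_pos_eq (r ^ i)); auto using Rlt_le. }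
  exists (fun i => Series (fun k => c k i)). split; [|split].
  - exact (ex_series_ext _ _ E S1).
  - now rewrite <- (Series_ext _ _ E).
  - intros h Hh.
    rewrite (Series_ext (fun k => f k (s0 + h)) (fun k => Series (fun i => c k i * h ^ i))).
    + apply is_series_ext with (fun i => Series (fun k => c k i * h ^ i)).
      { intros i. apply Series_scal_r. }
      apply (series_swap (fun k i => c k i * h ^ i) M); auto; intros k; now apply Ha.
    + intros k. symmetry. apply is_series_unique. now apply Hc.
Qed.

Lemma analytic_at_ext_loc (f g : R -> R) (x0 : R) :
  locally x0 (fun x => f x = g x) -> analytic_at f x0 -> analytic_at g x0.
Proof.
  intros [e He] (c & r & Hr & H). exists c, (Rmin r e). split.
  - apply Rmin_pos; [exact Hr|apply cond_pos].
  - intros x Hx. rewrite <- He.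
    + apply H. eapply Rlt_le_trans; [exact Hx|apply Rmin_l].
    + eapply Rlt_le_trans; [exact Hx|apply Rmin_r].
Qed.

Lemma analytic_at_plus (f g : R -> R) (x0 : R) :
  analytic_at f x0 -> analytic_at g x0 -> analytic_at (fun x => f x + g x) x0.
Proof.
  intros (c & r & Hr & H) (d & r' & Hr' & H'). exists (PS_plus c d), (Rmin r r'). split.
  - now apply Rmin_pos.
  - intros x Hx. apply (is_pseries_plus c d (x - x0) (f x) (g x)).
    + apply H. eapply Rlt_le_trans; [exact Hx|apply Rmin_l].
    + apply H'. eapply Rlt_le_trans; [exact Hx|apply Rmin_r].
Qed.

Lemma analytic_at_scal (f : R -> R) (k x0 : R) :
  analytic_at f x0 -> analytic_at (fun x => k * f x) x0.
Proof.
  intros (c & r & Hr & H). exists (PS_scal k c), r. split; [exact Hr|].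
  intros x Hx. apply (is_pseries_scal k c (x - x0) (f x)); [|now apply H].
  unfold mult; simpl; ring.
Qed.

Lemma analytic_at_mul_linear (f : R -> R) (t x0 : R) :
  analytic_at f x0 -> analytic_at (fun x => (x + t) * f x) x0.
Proof.
  intros (c & r & Hr & H).
  exists (PS_plus (PS_scal (x0 + t) c) (PS_incr_1 c)), r. split; [exact Hr|].
  intros x Hx. specialize (H x Hx).
  replace ((x + t) * f x) with (plus (scal (x0 + t) (f x)) (scal (x - x0) (f x)))
    by (unfold plus, scal; simpl; unfold mult; simpl; ring).
  apply (is_pseries_plus (PS_scal (x0 + t) c) (PS_incr_1 c) (x - x0)
           (scal (x0 + t) (f x)) (scal (x - x0) (f x))).
  - apply (is_pseries_scal (x0 + t) c (x - x0) (f x)); [unfold mult; simpl; ring|exact H].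
  - exact (is_pseries_incr_1 c (x - x0) (f x) H).
Qed.

Lemma analytic_at_sum_n (f : nat -> R -> R) (n : nat) (x0 : R) :
  (forall k, (k <= n)%nat -> analytic_at (f k) x0) ->
  analytic_at (fun x => sum_n (fun k => f k x) n) x0.
Proof.
  induction n as [|n IH]; intros H.
  - apply analytic_at_ext_loc with (f O); [|now apply H].
    apply filter_forall. intros x. now rewrite sum_O.
  - apply analytic_at_ext_loc with (fun x => sum_n (fun k => f k x) n + f (S n) x).
    + apply filter_forall. intros x. now rewrite sum_Sn.
    + apply analytic_at_plus; [apply IH; intros; apply H; lia|apply H; lia].
Qed.

Lemma analytic_at_shift (f : R -> R) (t x0 : R) :
  analytic_at f (x0 + t) -> analytic_at (fun x => f (x + t)) x0.
Proof.
  intros (c & r & Hr & H). exists c, r. split; [exact Hr|]. intros x Hx.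
  replace (x - x0) with (x + t - (x0 + t)) by ring. apply H.
  now replace (x + t - (x0 + t)) with (x - x0) by ring.
Qed.

Lemma CV_radius_gt (c : nat -> R) (x b : R) :
  Rabs x < b -> ex_series (fun i => c i * b ^ i) -> Rbar_lt (Rabs x) (CV_radius c).
Proof.
  intros Hb He. apply Rbar_lt_le_trans with (Rabs b).
  - simpl. pose proof (Rabs_pos x). rewrite (Rabs_pos_eq b); lra.
  - apply Rbar_not_lt_le. intros Hlt. apply (CV_disk_outside c b Hlt).
    now apply ex_series_lim_0.
Qed.

Lemma analytic_at_ex_derive (f : R -> R) (x0 : R) : analytic_at f x0 -> ex_derive f x0.
Proof.
  intros (c & r & Hr & H).
  assert (HR : Rbar_lt (Rabs 0) (CV_radius c)).
  { apply CV_radius_gt with (r / 2); [rewrite Rabs_R0; lra|].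
    exists (f (x0 + r / 2)). apply (proj1 (is_pseries_series _ _ _)).
    replace (r / 2) with (x0 + r / 2 - x0) at 1 by ring. apply H.
    replace (x0 + r / 2 - x0) with (r / 2) by ring. rewrite Rabs_pos_eq; lra. }
  apply ex_derive_ext_loc with (fun x => PSeries c (x - x0)).
  - exists (mkposreal r Hr). intros x Hx. apply is_pseries_unique, H, Hx.
  - apply (ex_derive_comp (PSeries c) (fun x => x - x0)).
    + rewrite Rminus_diag_eq by reflexivity. now apply ex_derive_PSeries.
    + auto_derive. exact I.
Qed.

Lemma analytic_at_continuous (f : R -> R) (x0 : R) : analytic_at f x0 -> continuous f x0.
Proof. intros H. now apply (ex_derive_continuous (V := R_NormedModule)), analytic_at_ex_derive. Qed.

(** The constant coefficient is the limit from the right at 0, hence zero; dividing the series by x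
    shifts the coefficients, so induction reaches all of them. *)
Lemma pseries_zero_on_right (c : nat -> R) (r : R) :
  0 < r -> (forall x, 0 < x < r -> is_pseries c x 0) ->
  (forall x, Rabs x < r -> ex_pseries c x) -> forall n, c n = 0.
Proof.
  intros Hr H0 Hex n. revert c H0 Hex.
  assert (Hc0 : forall c : nat -> R, (forall x, 0 < x < r -> is_pseries c x 0) ->
    (forall x, Rabs x < r -> ex_pseries c x) -> c O = 0).
  { intros c H0 Hex.
    assert (Hcont : continuous (PSeries c) 0).
    { apply (analytic_at_continuous (PSeries c) 0). exists c, r. split; [exact Hr|].
      intros x Hx. rewrite Rminus_0_r in *. apply PSeries_correct, Hex, Hx. }
    rewrite <- (PSeries_0 c).
    assert (L : filterlim (PSeries c) (at_right 0) (locally (PSeries c 0)))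
      by (apply filterlim_filter_le_1 with (2 := Hcont); apply filter_le_within).
    apply (filterlim_locally_unique (F := at_right 0) (PSeries c) _ _ L).
    apply filterlim_ext_loc with (fun _ => 0); [|apply filterlim_const].
    exists (mkposreal r Hr). intros x Hx Hx0. symmetry. apply is_pseries_unique, H0.
    split; [exact Hx0|]. unfold ball in Hx; simpl in Hx; unfold AbsRing_ball, abs, minus, plus, opp in Hx; simpl in Hx.
    apply Rabs_def2 in Hx. lra. }
  induction n as [|n IH]; intros c H0 Hex; [now apply Hc0|].
  specialize (Hc0 c H0 Hex).
  apply (IH (PS_decr_1 c)).
  - intros x Hx.
    assert (Hne : x <> 0) by lra.
    pose proof (is_pseries_decr_1 c x (/ x) 0) as Hd.
    replace 0 with (scal (/ x) (plus 0 (opp (c O)))).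
    + apply Hd; [unfold mult; simpl; now rewrite Rinv_l|now apply H0].
    + rewrite Hc0. unfold scal, plus, opp; simpl; unfold mult; simpl. ring.
  - intros x Hx. destruct (Req_dec x 0) as [->|Hne].
    + exists (PS_decr_1 c O). apply (is_pseries_0 (PS_decr_1 c)).
    + destruct (Hex x Hx) as [l Hl]. eexists.
      apply (is_pseries_decr_1 c x (/ x) l); [|exact Hl].
      unfold mult; simpl. now rewrite Rinv_l.
Qed.

Lemma analytic_zero_left (f : R -> R) (x0 : R) :
  analytic_at f x0 -> (forall x, x0 < x -> f x = 0) ->
  exists e, 0 < e /\ forall x, x0 - e < x -> f x = 0.
Proof.
  intros (c & r & Hr & H) H0. exists r. split; [exact Hr|].
  assert (E : forall y, Rabs y < r -> is_pseries c y (f (x0 + y))).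
  { intros y Hy. replace y with (x0 + y - x0) at 1 by ring. apply H.
    now replace (x0 + y - x0) with y by ring. }
  assert (Hz : forall n, c n = 0).
  { apply (pseries_zero_on_right c r Hr).
    - intros x Hx. rewrite <- (H0 (x0 + x)) by lra. apply E. rewrite Rabs_pos_eq; lra.
    - intros x Hx. eexists. now apply E. }
  intros x Hx. destruct (Rlt_dec x0 x) as [Hlt|Hge]; [now apply H0|].
  assert (Hr' : Rabs (x - x0) < r) by (apply Rabs_def1; lra).
  rewrite <- (is_pseries_unique _ _ _ (H x Hr')).
  unfold PSeries. rewrite (Series_ext _ (fun _ => 0)); [|intros; rewrite Hz; ring].
  apply is_series_unique, is_series_zero.
Qed.

Lemma analytic_identity (f : R -> R) (l b : R) :
  (forall x, l < x -> analytic_at f x) -> (forall x, b < x -> f x = 0) ->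
  forall x, l < x -> f x = 0.
Proof.
  intros Ha Hb x Hx.
  destruct (Rlt_dec b x) as [|Hbx]; [now apply Hb|].
  (* The infimum of the points to the right of which f vanishes; [completeness] yields suprema,
     hence the sign change. *)
  destruct (completeness (fun t => exists y, t = - y /\ l < y <= b + 1 /\ forall z, y < z -> f z = 0))
    as [t [Hub Hlub]].
  - exists (- l). intros t (y & -> & Hy & _). lra.
  - exists (- (b + 1)), (b + 1). repeat split; try lra. intros; apply Hb; lra.
  - assert (Hz : forall z, - t < z -> f z = 0).
    { intros z Hz. destruct (Classical_Prop.classic (f z = 0)) as [|Hne]; [assumption|exfalso].
      assert (t <= - z); [|lra]. apply Hlub. intros u (y & -> & Hy & Hy').
      destruct (Rlt_dec y z) as [Hyz|]; [|lra]. now elim Hne; apply Hy'. }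
    destruct (Rlt_dec (- t) x) as [|Hxt]; [now apply Hz|exfalso].
    destruct (analytic_zero_left f (- t)) as (e & He & He'); [apply Ha; lra|exact Hz|].
    (* A point strictly left of the infimum -t, still to the right of l (the second argument is the
       midpoint of l and -t) and inside the range where f has just been shown to vanish. *)
    set (y := Rmax (- t - e / 2) ((l - t) / 2)).
    assert (y < - t) by (apply Rmax_lub_lt; lra).
    assert (- t - e / 2 <= y) by apply Rmax_l.
    assert ((l - t) / 2 <= y) by apply Rmax_r.
    assert (- t <= b + 1).
    { assert (- (b + 1) <= t); [|lra]. apply Hub. exists (b + 1). repeat split; try lra.
      intros; apply Hb; lra. }
    assert (- y <= t); [|lra].
    apply Hub. exists y. repeat split; try lra.
    intros z Hyz. apply He'. lra.
Qed.

(** * The binomial series and the Taylor expansion of the Hurwitz zeta function *)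

Fixpoint poch (s : R) (n : nat) : R :=
  match n with O => 1 | S k => poch s k * (s + INR k) end.

Lemma poch_add (s : R) (n k : nat) : poch s (n + k) = poch s n * poch (s + INR n) k.
Proof.
  induction k as [|k IH]; simpl.
  - rewrite Nat.add_0_r. ring.
  - rewrite Nat.add_succ_r. simpl. rewrite IH, plus_INR. ring.
Qed.

Lemma poch_pos (s : R) (n : nat) : 0 < s -> 0 < poch s n.
Proof.
  intros Hs. induction n as [|n IH]; simpl; [lra|].
  apply Rmult_lt_0_compat; [exact IH|]. pose proof (pos_INR n). lra.
Qed.

(** The coefficient of u^j in (1 - u)^(-s). *)
Definition binom_coef (s : R) (j : nat) : R := poch s j / INR (fact j).

Lemma binom_coef_S (s : R) (j : nat) :
  INR (S j) * binom_coef s (S j) = (s + INR j) * binom_coef s j.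
Proof.
  unfold binom_coef. rewrite fact_simpl, mult_INR. simpl poch.
  field. split; [apply INR_fact_neq_0|apply not_0_INR; lia].
Qed.

Lemma CV_radius_binom_coef (s : R) : 0 < s -> CV_radius (binom_coef s) = 1.
Proof.
  intros Hs.
  assert (Hpos : forall n, 0 < binom_coef s n).
  { intros n. apply Rdiv_lt_0_compat; [now apply poch_pos|apply INR_fact_lt_0]. }
  rewrite (CV_radius_finite_DAlembert _ 1); [f_equal; field| |lra|].
  - intros n. apply Rgt_not_eq, Hpos.
  - apply is_lim_seq_ext with (fun n => 1 + (s - 1) * / INR (S n)).
    + intros n. pose proof (Hpos n). pose proof (binom_coef_S s n) as E.
      assert (0 < INR (S n)) by (apply lt_0_INR; lia).
      replace (binom_coef s (S n)) with ((s + INR n) * binom_coef s n / INR (S n))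
        by (rewrite <- E; field; lra).
      pose proof (pos_INR n). rewrite Rabs_pos_eq.
      * rewrite S_INR in *. field. lra.
      * apply Rlt_le, Rdiv_lt_0_compat; [|assumption].
        apply Rdiv_lt_0_compat; [|assumption]. apply Rmult_lt_0_compat; lra.
    + replace 1 with (1 + (s - 1) * 0) at 1 by ring.
      apply (is_lim_seq_plus' _ _ 1 ((s - 1) * 0)); [apply is_lim_seq_const|].
      apply (is_lim_seq_scal_l _ (s - 1) 0).
      apply (is_lim_seq_incr_1 (fun n => / INR n)).
      replace (Finite 0) with (Rbar_inv p_infty) by reflexivity.
      apply is_lim_seq_inv; [apply is_lim_seq_INR|discriminate].
Qed.

Lemma ex_series_binom (s u : R) : 0 < s -> Rabs u < 1 -> ex_series (fun j => binom_coef s j * u ^ j).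
Proof.
  intros Hs Hu.
  assert (H : ex_pseries (binom_coef s) u).
  { apply CV_radius_inside. now rewrite CV_radius_binom_coef. }
  destruct H as [l H]. exists l. exact (proj1 (is_pseries_series _ _ _) H).
Qed.

(** The recurrence [binom_coef_S] says that the sum f satisfies (1 - u) f' = s f, so f(u) (1 - u)^s
    has derivative zero and keeps its value 1 at the origin. *)
Lemma is_series_binom (s u : R) : 0 < s -> Rabs u < 1 ->
  is_series (fun j => binom_coef s j * u ^ j) (Rpower (1 - u) (- s)).
Proof.
  intros Hs Hu.
  set (b := binom_coef s). set (f := PSeries b).
  assert (HR : forall v, Rabs v < 1 -> Rbar_lt (Rabs v) (CV_radius b))
    by (intros v Hv; unfold b; now rewrite CV_radius_binom_coef).
  set (phi := fun v => f v * Rpower (1 - v) s).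
  assert (Hd : forall v, Rabs v < 1 -> is_derive phi v 0).
  { intros v Hv. pose proof (Rabs_def2 _ _ Hv).
    pose proof (is_derive_PSeries b v (HR v Hv)) as Hf.
    set (f' := PSeries (PS_derive b) v) in *.
    assert (E : s * f v + v * f' = f').
    { unfold f, f'. rewrite <- PSeries_scal, <- PSeries_incr_1, <- PSeries_plus.
      - apply PSeries_ext. intros [|n]; unfold PS_plus, PS_scal, PS_incr_1, PS_derive, plus, scal; simpl; unfold mult; simpl.
        + pose proof (binom_coef_S s 0) as E0. simpl INR in E0. fold b in E0. unfold zero; simpl. lra.
        + pose proof (binom_coef_S s (S n)) as E0. fold b in E0.
          change (match n with O => 1 | S _ => INR n + 1 end) with (INR (S n)).
          change (INR (S n) + 1) with (INR (S (S n))). rewrite E0. ring.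
      - apply CV_radius_inside. eapply Rbar_lt_le_trans; [apply (HR v Hv)|].
        destruct (Req_dec s 0) as [->|]; [lra|]. now rewrite CV_radius_scal by assumption; apply Rbar_le_refl.
      - apply CV_radius_inside. rewrite CV_radius_incr_1, CV_radius_derive. now apply HR. }
    replace 0 with (f' * Rpower (1 - v) s + f v * (- (s * Rpower (1 - v) (s - 1)))).
    - apply (is_derive_mult f (fun v => Rpower (1 - v) s) v); [exact Hf| |intros; apply Rmult_comm].
      assert (Hp : is_derive (fun w => Rpower w s) (1 - v) (s * Rpower (1 - v) (s - 1)))
        by (apply is_derive_Reals, derivable_pt_lim_power; lra).
      evar_last; [apply (is_derive_comp (fun w => Rpower w s) (fun v => 1 - v) v _ (-1) Hp)|].
      + auto_derive; [exact I|ring].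
      + unfold scal; simpl; unfold mult; simpl; ring.
    - replace (Rpower (1 - v) s) with (Rpower (1 - v) (s - 1) * (1 - v)).
      + replace (f' * (Rpower (1 - v) (s - 1) * (1 - v)) + f v * - (s * Rpower (1 - v) (s - 1)))
          with (Rpower (1 - v) (s - 1) * (f' - (s * f v + v * f'))) by ring.
        rewrite E. ring.
      + rewrite <- (Rpower_1 (1 - v)) at 2 by lra. rewrite <- Rpower_plus. f_equal. ring. }
  assert (E1 : phi 0 = 1).
  { unfold phi, f. rewrite PSeries_0. unfold b, binom_coef. simpl.
    rewrite Rminus_0_r. unfold Rpower. rewrite ln_1, Rmult_0_r, exp_0. field. }
  assert (E : phi u = 1).
  { rewrite <- E1. destruct (Rtotal_order u 0) as [H|[->|H]]; [|reflexivity|].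
    - apply (eq_is_derive phi u 0); [|exact H]. intros t Ht. apply Hd.
      apply Rabs_def2 in Hu. apply Rabs_def1; lra.
    - symmetry. apply (eq_is_derive phi 0 u); [|exact H]. intros t Ht. apply Hd.
      apply Rabs_def2 in Hu. apply Rabs_def1; lra. }
  apply (proj1 (is_pseries_series _ _ _)).
  replace (Rpower (1 - u) (- s)) with (PSeries b u).
  - apply PSeries_correct, CV_radius_inside, HR, Hu.
  - rewrite Rpower_Ropp. unfold phi, f in E.
    apply Rmult_eq_reg_r with (Rpower (1 - u) s); [|apply Rgt_not_eq, exp_pos].
    rewrite E. field. apply Rgt_not_eq, exp_pos.
Qed.

Lemma Rpower_sub_INR (y s : R) (j : nat) : 0 < y -> Rpower y (- (s + INR j)) = Rpower y (- s) / y ^ j.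
Proof.
  intros Hy. replace (- (s + INR j)) with (- s + - INR j) by ring.
  now rewrite Rpower_plus, (Rpower_Ropp y (INR j)), Rpower_pow.
Qed.

Lemma is_series_shifted_power (y s a : R) : 1 <= y -> 0 < s -> Rabs a < 1 ->
  is_series (fun j => binom_coef s j * (- a) ^ j * Rpower y (- (s + INR j)))
    (Rpower (y + a) (- s)).
Proof.
  intros Hy Hs Ha.
  assert (Hu : Rabs (- a / y) < 1).
  { unfold Rdiv. rewrite Rabs_mult, Rabs_Ropp, Rabs_inv, (Rabs_pos_eq y) by lra.
    apply Rmult_lt_reg_r with y; [lra|]. rewrite Rmult_assoc, Rinv_l, Rmult_1_r; lra. }
  apply (is_series_eq (fun j => Rpower y (- s) * (binom_coef s j * (- a / y) ^ j)) _
           (Rpower y (- s) * Rpower (1 - - a / y) (- s))).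
  - intros j. rewrite Rpower_sub_INR by lra. unfold Rdiv. rewrite Rpow_mult_distr, pow_inv. ring.
  - apply Rabs_def2 in Hu. rewrite Rpower_mult_distr by lra. f_equal. field. lra.
  - now apply is_series_Rmult, is_series_binom.
Qed.

(** Each term (k + 1 + a)^(-s) is expanded around k + 1 and the sums are exchanged. As k + 1 >= 1,
    the power (k + 1)^(-(s + j)) is at most (k + 1)^(-s), which makes the majorant a product of two
    convergent series. Centring at 1 keeps every expansion valid for |a| < 1. *)
Lemma hurwitz_taylor (Z : R -> R -> R) (HZ : is_HurwitzZeta Z) (s a : R) :
  1 < s -> Rabs a < 1 ->
  is_series (fun j => binom_coef s j * (- a) ^ j * Z (s + INR j) 1) (Z s (1 + a)).
Proof.
  intros Hs Ha.
  assert (Hk : forall k, 1 <= INR k + 1) by (intros k; pose proof (pos_INR k); lra).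
  set (c := fun k j => binom_coef s j * (- a) ^ j * Rpower (INR k + 1) (- (s + INR j))).
  assert (Hb : forall j, 0 <= binom_coef s j).
  { intros j. apply Rlt_le, Rdiv_lt_0_compat; [apply poch_pos; lra|apply INR_fact_lt_0]. }
  assert (eB : ex_series (fun j => binom_coef s j * Rabs a ^ j))
    by (apply ex_series_binom; [lra|now rewrite Rabs_Rabsolu]).
  assert (Hle : forall k j, 0 <= Rabs (c k j) <= Rpower (INR k + 1) (- s) * (binom_coef s j * Rabs a ^ j)).
  { intros k j. split; [apply Rabs_pos|]. unfold c.
    rewrite !Rabs_mult, <- RPow_abs, Rabs_Ropp, (Rabs_pos_eq (binom_coef s j)) by apply Hb.
    rewrite (Rabs_pos_eq (Rpower _ _)) by (left; apply exp_pos).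
    rewrite Rmult_comm. apply Rmult_le_compat_r.
    - apply Rmult_le_pos; [apply Hb|apply pow_le, Rabs_pos].
    - apply Rle_Rpower; [apply Hk|]. pose proof (pos_INR j). lra. }
  assert (eR : forall k, ex_series (fun j => Rpower (INR k + 1) (- s) * (binom_coef s j * Rabs a ^ j)))
    by (intros k; exact (ex_series_scal (Rpower (INR k + 1) (- s)) _ eB)).
  destruct (HZ 1 Rlt_0_1) as [HZ1 _].
  assert (Ha' : 0 < 1 + a) by (apply Rabs_def2 in Ha; lra).
  destruct (HZ _ Ha') as [HZa _].
  assert (HS := series_swap c (fun k => Rpower (INR k + 1) (- s) * Series (fun j => binom_coef s j * Rabs a ^ j))).
  eapply is_series_eq; [| |apply HS].
  - intros j. simpl. unfold c. rewrite Series_scal_l. f_equal.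
    apply is_series_unique, HZ1. pose proof (pos_INR j). lra.
  - rewrite <- (is_series_unique _ _ (HZa s Hs)). apply Series_ext. intros k.
    apply is_series_unique. unfold c.
    replace (INR k + (1 + a)) with (INR k + 1 + a) by ring.
    apply is_series_shifted_power; [apply Hk|lra|exact Ha].
  - intros k. apply ex_series_Rabs_le with (2 := eR k). intros j. rewrite Rabs_Rabsolu. apply Hle.
  - intros k. rewrite <- Series_scal_l. apply Series_le; [apply Hle|apply eR].
  - apply (ex_series_scal_r (Series (fun j => binom_coef s j * Rabs a ^ j)) (fun k => Rpower (INR k + 1) (- s))).
    eexists. now apply HZ1.
Qed.

(** * Continuation of the Taylor expansion *)

(** Positivity of s0 + t removes the absolute values from the linear factors, so the product of
    their norms is again a Pochhammer symbol, taken at the right end of the disk. *)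
Lemma majorized_poch_mul (f : R -> R) (s0 r M t : R) (n : nat) :
  0 <= r -> 0 < s0 + t -> majorized f s0 r M ->
  majorized (fun s => poch (s + t) n * f s) s0 r (poch (s0 + t + r) n * M).
Proof.
  intros Hr Ht Hf. induction n as [|n IH].
  - apply majorized_ext with f; [intros h _; simpl; ring|].
    apply majorized_le with M; [simpl; lra|exact Hf].
  - apply majorized_ext with (fun s => (s + (t + INR n)) * (poch (s + t) n * f s)).
    + intros h _. simpl. ring.
    + apply majorized_le with ((Rabs (s0 + (t + INR n)) + r) * (poch (s0 + t + r) n * M)).
      * rewrite Rabs_pos_eq by (pose proof (pos_INR n); lra). right. simpl. ring.
      * now apply majorized_mul_linear.
Qed.

Lemma majorized_zeta (Z : R -> R -> R) (HZ : is_HurwitzZeta Z) (s0 r t : R) :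
  0 < r -> 1 < s0 + t - r -> majorized (fun s => Z (s + t) 1) s0 r (Z (s0 + t - r) 1).
Proof.
  intros Hr Ht. destruct (HZ 1 Rlt_0_1) as [H1 _].
  rewrite <- (is_series_unique _ _ (H1 _ Ht)).
  apply majorized_ext with (fun s => Series (fun k => Rpower (INR k + 1) (- (s + t)))).
  - intros h Hh. apply is_series_unique, H1.
    assert (- r <= h) by (unfold Rabs in Hh; destruct (Rcase_abs h); lra). lra.
  - apply majorized_Series; [exact Hr| |eexists; now apply H1].
    intros k. apply majorized_Rpower; [pose proof (pos_INR k)|]; lra.
Qed.

Lemma zeta_decreasing (Z : R -> R -> R) (HZ : is_HurwitzZeta Z) (s t : R) :
  1 < s -> s <= t -> 0 <= Z t 1 <= Z s 1.
Proof.
  intros Hs Hst. destruct (HZ 1 Rlt_0_1) as [H1 _].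
  assert (Ht : 1 < t) by lra.
  assert (H0 : forall k, 0 <= Rpower (INR k + 1) (- t)) by (intros; left; apply exp_pos).
  rewrite <- (is_series_unique _ _ (H1 s Hs)), <- (is_series_unique _ _ (H1 t Ht)). split.
  - eapply Rle_trans; [apply (H0 O)|].
    apply (term_le_Series (fun k => Rpower (INR k + 1) (- t))); [exact H0|].
    eexists; now apply H1.
  - apply Series_le; [|eexists; now apply H1]. intros k. split; [apply H0|].
    apply Rle_Rpower; [pose proof (pos_INR k); lra|lra].
Qed.

(* The factor [(-1) ^ j - 1] removes the even indices, the only ones for which [s + j] can reach the pole when [s = 1 - 2m]. *)
Definition odd_taylor_coef (Z : R -> R -> R) (j : nat) (s : R) : R :=
  ((-1) ^ j - 1) * binom_coef s j * Z (s + INR j) 1.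

(** The term of index S N + n with [poch s N] taken out. For s > -N the remaining Pochhammer symbol
    has a positive base and the zeta value lies in the half-line of convergence. For N = 2m the
    removed factor is the one that vanishes at 1 - 2m. *)
Definition odd_tail_term (Z : R -> R -> R) (N : nat) (a : R) (n : nat) (s : R) : R :=
  ((-1) ^ (S N + n) - 1) * a ^ (S N + n) / INR (fact (S N + n)) *
    (poch (s + INR N) (S n) * Z (s + INR (S N + n)) 1).

Definition odd_taylor_tail (Z : R -> R -> R) (N : nat) (a s : R) : R :=
  Series (fun n => odd_tail_term Z N a n s).

Lemma odd_taylor_coef_tail (Z : R -> R -> R) (N : nat) (s : R) (n : nat) :
  odd_taylor_coef Z (S N + n) s =
  poch s N * (((-1) ^ (S N + n) - 1) / INR (fact (S N + n)) *
    (poch (s + INR N) (S n) * Z (s + INR (S N + n)) 1)).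
Proof.
  unfold odd_taylor_coef, binom_coef.
  replace (poch s (S N + n)) with (poch s N * poch (s + INR N) (S n)).
  - unfold Rdiv; ring.
  - rewrite <- poch_add. f_equal. lia.
Qed.

Lemma Rabs_pow_m1_minus_1 (j : nat) : Rabs ((-1) ^ j - 1) <= 2.
Proof.
  unfold Rminus. eapply Rle_trans; [apply Rabs_triang|].
  rewrite pow_1_abs, Rabs_Ropp, Rabs_R1. lra.
Qed.

(** The zeta values are largest at the first index, hence at most [C]; replacing [S N + n] by [S n]
    in the factorial and in the power of a < 1 only enlarges the term. What remains is a binomial
    series at [sg], convergent at a. *)
Lemma odd_tail_term_majorized (Z : R -> R -> R) (HZ : is_HurwitzZeta Z) (N : nat) (a s0 : R) :
  0 < a < 1 -> - INR N < s0 ->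
  exists (r : R) (M : nat -> R), 0 < r /\ ex_series M /\
    forall n, majorized (odd_tail_term Z N a n) s0 r (M n).
Proof.
  (* Half the distance from s0 to -N: the first zeta argument, moved to the left end of the disk, is
     then 1 + r > 1. *)
  intros Ha Hs0. set (r := (s0 + INR N) / 2).
  assert (Hr : 0 < r) by (unfold r; lra).
  set (sg := s0 + INR N + r). set (C := Z (s0 + INR (S N) - r) 1).
  assert (HC : 1 < s0 + INR (S N) - r) by (rewrite S_INR; unfold r; lra).
  set (M := fun n => Rabs (((-1) ^ (S N + n) - 1) * a ^ (S N + n) / INR (fact (S N + n))) *
                (poch sg (S n) * Z (s0 + INR (S N + n) - r) 1)).
  assert (Hj : forall n, s0 + INR (S N) - r <= s0 + INR (S N + n) - r)
    by (intros n; rewrite plus_INR; pose proof (pos_INR n); lra).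
  exists r, M. split; [exact Hr|split].
  2: { intros n. apply majorized_scal.
    apply majorized_poch_mul; [lra|lra|].
    apply majorized_zeta; [exact HZ|exact Hr|]. specialize (Hj n). lra. }
  apply ex_series_Rabs_le with (fun n => 2 * C * (binom_coef sg (S n) * a ^ S n)).
    + intros n. unfold M.
      destruct (zeta_decreasing Z HZ _ _ HC (Hj n)) as [Z0 ZC]. fold C in ZC.
      assert (Pp : 0 < poch sg (S n)) by (apply poch_pos; unfold sg; lra).
      rewrite Rabs_pos_eq.
      2: { apply Rmult_le_pos; [apply Rabs_pos|]. apply Rmult_le_pos; lra. }
      unfold Rdiv. rewrite !Rabs_mult, Rabs_inv.
      rewrite (Rabs_pos_eq (a ^ _)) by (apply pow_le; lra).
      rewrite (Rabs_pos_eq (INR _)) by apply pos_INR.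
      assert (F1 : INR (fact (S n)) <= INR (fact (S N + n))) by (apply le_INR, fact_le; lia).
      assert (F2 : / INR (fact (S N + n)) <= / INR (fact (S n)))
        by (apply Rinv_le_contravar; [apply INR_fact_lt_0|exact F1]).
      assert (F3 : a ^ (S N + n) <= a ^ S n).
      { replace (S N + n)%nat with (S n + N)%nat by lia. rewrite pow_add.
        rewrite <- (Rmult_1_r (a ^ S n)) at 2. apply Rmult_le_compat_l; [apply pow_le; lra|].
        rewrite <- (pow1 N). apply pow_incr. lra. }
      assert (F4 : 0 < a ^ (S N + n)) by (apply pow_lt; lra).
      assert (F5 : 0 < / INR (fact (S N + n))) by apply Rinv_0_lt_compat, INR_fact_lt_0.
      pose proof (Rabs_pow_m1_minus_1 (S N + n)) as F6.
      replace (2 * C * (binom_coef sg (S n) * a ^ S n)) with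
        (2 * a ^ S n * / INR (fact (S n)) * (poch sg (S n) * C))
        by (unfold binom_coef, Rdiv; ring).
      assert (F7 : 0 <= Rabs ((-1) ^ (S N + n) - 1)) by apply Rabs_pos.
      assert (F8 : 0 <= Rabs ((-1) ^ (S N + n) - 1) * a ^ (S N + n)) by (apply Rmult_le_pos; lra).
      apply Rmult_le_compat.
      * apply Rmult_le_pos; lra.
      * apply Rmult_le_pos; lra.
      * apply Rmult_le_compat; try lra. apply Rmult_le_compat; lra.
      * apply Rmult_le_compat_l; lra.
    + apply (ex_series_scal (2 * C) (fun n => binom_coef sg (S n) * a ^ S n)).
      apply (ex_series_incr_1 (fun n => binom_coef sg n * a ^ n)).
      apply ex_series_binom; [unfold sg; lra|rewrite Rabs_pos_eq; lra].
Qed.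

Lemma odd_taylor_tail_analytic (Z : R -> R -> R) (HZ : is_HurwitzZeta Z) (N : nat) (a s0 : R) :
  0 < a < 1 -> - INR N < s0 -> analytic_at (odd_taylor_tail Z N a) s0.
Proof.
  intros Ha Hs0. destruct (odd_tail_term_majorized Z HZ N a s0 Ha Hs0) as (r & M & Hr & eM & HM).
  apply (majorized_analytic _ s0 r (Series M) Hr). now apply majorized_Series.
Qed.

Lemma ex_series_odd_tail_term (Z : R -> R -> R) (HZ : is_HurwitzZeta Z) (N : nat) (a s0 : R) :
  0 < a < 1 -> - INR N < s0 -> ex_series (fun n => odd_tail_term Z N a n s0).
Proof.
  intros Ha Hs0. destruct (odd_tail_term_majorized Z HZ N a s0 Ha Hs0) as (r & M & Hr & eM & HM).
  apply ex_series_Rabs_le with (2 := eM). intros n. apply majorized_bound with r; [lra|apply HM].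
Qed.

Lemma is_series_odd_taylor (Z : R -> R -> R) (HZ : is_HurwitzZeta Z) (s a : R) :
  1 < s -> 0 < a < 1 ->
  is_series (fun j => odd_taylor_coef Z j s * a ^ j) (Z s (1 + a) - Z s (1 - a)).
Proof.
  intros Hs Ha.
  assert (Ha1 : Rabs a < 1) by (rewrite Rabs_pos_eq; lra).
  assert (Ha2 : Rabs (- a) < 1) by now rewrite Rabs_Ropp.
  pose proof (is_series_minus _ _ _ _ (hurwitz_taylor Z HZ s a Hs Ha1) (hurwitz_taylor Z HZ s (- a) Hs Ha2)) as H.
  eapply is_series_eq; [| |exact H].
  - intros j. unfold odd_taylor_coef, minus, plus, opp; simpl.
    rewrite Ropp_involutive. replace (- a) with (-1 * a) by ring. rewrite Rpow_mult_distr. ring.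
  - reflexivity.
Qed.

Lemma odd_taylor_split (Z : R -> R -> R) (HZ : is_HurwitzZeta Z) (N : nat) (s a : R) :
  1 < s -> 0 < a < 1 ->
  Z s (1 + a) - Z s (1 - a) =
  sum_n (fun j => odd_taylor_coef Z j s * a ^ j) N + poch s N * odd_taylor_tail Z N a s.
Proof.
  intros Hs Ha. pose proof (is_series_odd_taylor Z HZ s a Hs Ha) as H.
  rewrite <- (is_series_unique _ _ H).
  rewrite (Series_incr_n _ (S N)) by (try lia; now exists (Z s (1 + a) - Z s (1 - a))).
  simpl pred. rewrite <- sum_n_Reals. f_equal.
  unfold odd_taylor_tail. rewrite <- Series_scal_l. apply Series_ext. intros n.
  rewrite odd_taylor_coef_tail. unfold odd_tail_term, Rdiv. ring.
Qed.

(* [(s - 1) * binom_coef s j * Z (s + j) 1] with its removable singularity at [s = 1 - j] filled in, when [j > 0]. *)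
Definition reg_taylor_coef (g : R -> R) (j : nat) (s : R) : R :=
  ((-1) ^ j - 1) / INR (fact j) * ((s - 1) * (poch s (pred j) * g (s + INR j))).

Lemma reg_taylor_coef_analytic (g : R -> R) (j : nat) (s0 : R) :
  (forall x, analytic_at g x) -> analytic_at (reg_taylor_coef g j) s0.
Proof.
  intros Hg. apply analytic_at_scal.
  apply (analytic_at_mul_linear (fun s => poch s (pred j) * g (s + INR j)) (-1) s0).
  induction (pred j) as [|n IH].
  - apply analytic_at_ext_loc with (fun s => g (s + INR j)).
    + apply filter_forall. intros s. simpl. ring.
    + apply analytic_at_shift, Hg.
  - apply analytic_at_ext_loc with (fun s => (s + INR n) * (poch s n * g (s + INR j))).
    + apply filter_forall. intros s. simpl. ring.
    + now apply analytic_at_mul_linear.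
Qed.

(** For odd j the last factor s + j - 1 of [poch s j] is exactly the one by which [g] regularises
    zeta at s + j. For even j both sides vanish, so the pole has to be excluded only for odd j; this
    also covers j = 0, where [pred] truncates. *)
Lemma reg_taylor_coef_eq (Z : R -> R -> R) (g : R -> R) (j : nat) (s : R) :
  (forall s, s <> 1 -> g s = (s - 1) * Z s 1) -> (Nat.Odd j -> s + INR j <> 1) ->
  reg_taylor_coef g j s = (s - 1) * odd_taylor_coef Z j s.
Proof.
  intros Hg Hj. unfold reg_taylor_coef, odd_taylor_coef, binom_coef.
  destruct (Nat.Even_or_Odd j) as [[k ->]|Ho].
  - replace ((-1) ^ (2 * k)) with 1; [unfold Rdiv; ring|].
    now rewrite pow_1_even.
  - rewrite Hg by auto. destruct j as [|n].
    + destruct Ho as [k Hk]; lia.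
    + simpl pred. simpl poch. rewrite S_INR. unfold Rdiv; ring.
Qed.

Lemma analytic_at_poch_mul (f : R -> R) (n : nat) (s0 : R) :
  analytic_at f s0 -> analytic_at (fun s => poch s n * f s) s0.
Proof.
  intros Hf. induction n as [|n IH].
  - apply analytic_at_ext_loc with f; [|exact Hf].
    apply filter_forall. intros s. simpl. ring.
  - apply analytic_at_ext_loc with (fun s => (s + INR n) * (poch s n * f s)).
    + apply filter_forall. intros s. simpl. ring.
    + now apply analytic_at_mul_linear.
Qed.

Lemma odd_taylor_continuation (Z : R -> R -> R) (HZ : is_HurwitzZeta Z) (N : nat) (s a : R) :
  0 < a < 1 -> - INR N < s -> s <> 1 -> (forall j, Nat.Odd j -> s + INR j <> 1) ->
  Z s (1 + a) - Z s (1 - a) =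
  sum_n (fun j => odd_taylor_coef Z j s * a ^ j) N + poch s N * odd_taylor_tail Z N a s.
Proof.
  intros Ha HN Hs1 Hj.
  destruct (HZ 1 Rlt_0_1) as [_ (g1 & A1 & E1)].
  destruct (HZ (1 + a) ltac:(lra)) as [_ (gp & Ap & Ep)].
  destruct (HZ (1 - a) ltac:(lra)) as [_ (gm & Am & Em)].
  (* The defect of the expansion multiplied by s - 1, with each zeta factor outside the tail
     replaced by its regularised version, so that it is analytic on all of s > -N, including s =
     1. *)
  set (H := fun s => (gp s + -1 * gm s) +
    (-1 * sum_n (fun j => a ^ j * reg_taylor_coef g1 j s) N +
     -1 * ((s + -1) * (poch s N * odd_taylor_tail Z N a s)))).
  assert (Esum : forall t, (forall j, Nat.Odd j -> t + INR j <> 1) ->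
    sum_n (fun j => a ^ j * reg_taylor_coef g1 j t) N =
    (t - 1) * sum_n (fun j => odd_taylor_coef Z j t * a ^ j) N).
  { intros t Ht. rewrite <- (sum_n_mult_l (K := R_Ring) (t - 1)). apply sum_n_ext. intros j.
    rewrite (reg_taylor_coef_eq Z g1) by auto. unfold mult; simpl. ring. }
  assert (H0 : H s = 0).
  { apply (analytic_identity H (- INR N) 1); [| |exact HN].
    - intros t Ht. apply analytic_at_plus.
      + apply analytic_at_plus; [exact (Ap t)|]. apply analytic_at_scal, Am.
      + apply analytic_at_plus; apply analytic_at_scal.
        * apply analytic_at_sum_n. intros j _. apply analytic_at_scal.
          now apply reg_taylor_coef_analytic.
        * apply analytic_at_mul_linear, analytic_at_poch_mul.
          now apply odd_taylor_tail_analytic.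
    - intros t Ht. unfold H. rewrite Ep, Em, Esum by (try lra; intros j _; pose proof (pos_INR j); lra).
      pose proof (odd_taylor_split Z HZ N t a Ht Ha). nra. }
  unfold H in H0. rewrite Ep, Em, Esum in H0 by auto.
  apply Rmult_eq_reg_l with (s - 1); lra.
Qed.

Lemma hurwitz_shift (Z : R -> R -> R) (HZ : is_HurwitzZeta Z) (s a : R) :
  0 < a -> s <> 1 -> Z s a = Rpower a (- s) + Z s (1 + a).
Proof.
  intros Ha Hs.
  destruct (HZ a Ha) as [S0 (g0 & A0 & E0)].
  destruct (HZ (1 + a) ltac:(lra)) as [Sp (gp & Ap & Ep)].
  assert (H0 : g0 s + (-1 * ((s + -1) * Rpower a (- s)) + -1 * gp s) = 0).
  (* All functions involved are analytic on the whole line, so any lower end below s serves; s - 1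
     is one. *)
  { apply (analytic_identity (fun s => g0 s + (-1 * ((s + -1) * Rpower a (- s)) + -1 * gp s)) (s - 1) 1); [| |lra].
    - intros t _. apply analytic_at_plus; [exact (A0 t)|].
      apply analytic_at_plus; apply analytic_at_scal; [|exact (Ap t)].
      apply analytic_at_mul_linear, analytic_at_Rpower.
    - intros t Ht. rewrite E0, Ep by lra.
      enough (E : Z t a = Rpower a (- t) + Z t (1 + a)) by (rewrite E; ring).
      rewrite <- (is_series_unique _ _ (S0 t Ht)), <- (is_series_unique _ _ (Sp t Ht)).
      rewrite Series_incr_1 by (eexists; now apply S0).
      f_equal; [f_equal; simpl; ring|]. apply Series_ext. intros k. f_equal. rewrite S_INR. ring. }
  rewrite E0, Ep in H0 by exact Hs.
  apply Rmult_eq_reg_l with (s - 1); lra.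
Qed.

(** * Derivatives at the negative odd integers *)

Lemma is_derive_eq (f : R -> R) (x l l' : R) : l = l' -> is_derive f x l -> is_derive f x l'.
Proof. now intros <-. Qed.

Lemma ex_derive_poch (n : nat) (s : R) : ex_derive (fun s => poch s n) s.
Proof.
  induction n as [|n IH]; simpl.
  - apply (ex_derive_const 1).
  - apply (ex_derive_mult (fun s => poch s n) (fun s => s + INR n)); [exact IH|].
    auto_derive. exact I.
Qed.

Lemma locally_neq (x y : R) : x <> y -> locally x (fun z => z <> y).
Proof.
  intros H. assert (Hp : 0 < Rabs (x - y)) by (apply Rabs_pos_lt; lra).
  exists (mkposreal _ Hp). intros z Hz ->.
  unfold ball in Hz; simpl in Hz; unfold AbsRing_ball, abs, minus, plus, opp in Hz; simpl in Hz.
  rewrite <- Rabs_Ropp in Hz. replace (- (y + - x)) with (x - y) in Hz by ring. lra.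
Qed.

Lemma ex_derive_hurwitz (Z : R -> R -> R) (HZ : is_HurwitzZeta Z) (b s : R) :
  0 < b -> s <> 1 -> ex_derive (fun t => Z t b) s.
Proof.
  intros Hb Hs. destruct (HZ b Hb) as [_ (g & Ag & Eg)].
  apply ex_derive_ext_loc with (fun t => g t * / (t - 1)).
  - apply filter_imp with (2 := locally_neq s 1 Hs). intros t Ht.
    rewrite Eg by exact Ht. eqR. field. lra.
  - apply (ex_derive_mult g (fun t => / (t - 1))).
    + apply analytic_at_ex_derive, Ag.
    + auto_derive. lra.
Qed.

Lemma odd_taylor_coef_even (Z : R -> R -> R) (j : nat) (s : R) :
  Nat.Even j -> odd_taylor_coef Z j s = 0.
Proof. intros [k ->]. unfold odd_taylor_coef. rewrite pow_1_even. ring. Qed.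

Lemma ex_derive_odd_taylor_coef (Z : R -> R -> R) (HZ : is_HurwitzZeta Z) (j : nat) (s : R) :
  (Nat.Odd j -> s + INR j <> 1) -> ex_derive (odd_taylor_coef Z j) s.
Proof.
  intros Hj. destruct (Nat.Even_or_Odd j) as [He|Ho].
  - apply ex_derive_ext with (fun _ => 0); [intros; now rewrite odd_taylor_coef_even|].
    apply (ex_derive_const 0).
  - apply (ex_derive_mult (fun s => ((-1) ^ j - 1) * binom_coef s j) (fun s => Z (s + INR j) 1)).
    + apply (ex_derive_scal (fun s => binom_coef s j)).
      apply ex_derive_ext with (fun s => / INR (fact j) * poch s j).
      { intros t. apply Rmult_comm. }
      apply (ex_derive_scal (fun s => poch s j)), ex_derive_poch.
    + apply (ex_derive_comp (fun t => Z t 1) (fun s => s + INR j)).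
      * apply ex_derive_hurwitz; [exact HZ|lra|auto].
      * auto_derive. exact I.
Qed.

Lemma odd_taylor_coef_rec (Z : R -> R -> R) (j : nat) (s : R) :
  INR (S j) * INR (S (S j)) * odd_taylor_coef Z (S (S j)) s =
  s * (s + 1) * odd_taylor_coef Z j (s + 2).
Proof.
  unfold odd_taylor_coef, binom_coef.
  replace (poch s (S (S j))) with (s * (s + 1) * poch (s + 2) j).
  - replace (s + INR (S (S j))) with (s + 2 + INR j) by (rewrite !S_INR; ring).
    rewrite !fact_simpl, !mult_INR. simpl pow. field.
    repeat split; [apply INR_fact_neq_0|apply not_0_INR; lia|apply not_0_INR; lia].
  - change (S (S j)) with (2 + j)%nat. rewrite poch_add. simpl. f_equal. ring.
Qed.

Definition neg_odd (m : nat) : R := 1 - 2 * INR m.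

Lemma neg_odd_pole (m j : nat) : Nat.Odd j -> neg_odd m + INR j <> 1.
Proof.
  intros [k ->]. unfold neg_odd. rewrite plus_INR, mult_INR. simpl (INR 2). simpl (INR 1).
  intros H. assert (E : 2 * INR k + 1 = 2 * INR m) by lra.
  assert (E' : INR (2 * k + 1) = INR (2 * m)) by (rewrite plus_INR, !mult_INR; simpl; lra).
  apply INR_eq in E'. lia.
Qed.

(** The points 1 - j with j odd are even integers, and the ball of radius 1 around 1 - 2m is the
    open interval between the consecutive even integers -2m and 2 - 2m. *)
Lemma neg_odd_near_pole (m : nat) : (1 <= m)%nat ->
  locally (neg_odd m) (fun s => - INR (2 * m) < s /\ s <> 1 /\ forall j, Nat.Odd j -> s + INR j <> 1).
Proof.
  intros Hm. exists (mkposreal 1 Rlt_0_1). intros s Hs.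
  unfold ball in Hs; simpl in Hs; unfold AbsRing_ball, abs, minus, plus, opp in Hs; simpl in Hs.
  apply Rabs_def2 in Hs. unfold neg_odd in Hs. rewrite mult_INR. simpl (INR 2).
  assert (1 <= INR m) by (apply (le_INR 1); exact Hm).
  repeat split; try lra.
  intros j [k ->] H0. rewrite plus_INR, mult_INR in H0. simpl (INR 2) in H0. simpl (INR 1) in H0.
  assert (2 * INR k < 2 * INR m) by lra.
  assert (2 * INR m < 2 * INR k + 2) by lra.
  assert (k < m)%nat by (apply INR_lt; lra).
  assert (m < S k)%nat by (apply INR_lt; rewrite S_INR; lra). lia.
Qed.

Definition taylor_value (Z : R -> R -> R) (m j : nat) : R := odd_taylor_coef Z j (neg_odd m).
Definition taylor_deriv (Z : R -> R -> R) (m j : nat) : R := Derive (odd_taylor_coef Z j) (neg_odd m).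

Definition hurwitz_deriv (Z : R -> R -> R) (m : nat) (a : R) : R := Derive (fun s => Z s a) (1 - 2 * INR m).
Definition odd_zeta_deriv (Z : R -> R -> R) (m : nat) (a : R) : R := hurwitz_deriv Z m a - hurwitz_deriv Z m (1 - a).

Lemma is_derive_mul_vanishing (h : R -> R) (c : R) :
  ex_derive h c -> is_derive (fun s => (s - c) * h s) c (h c).
Proof.
  intros [d Hd].
  apply is_derive_eq with (1 * h c + (c - c) * d); [ring|].
  apply (is_derive_mult (fun s => s - c) h c 1 d); [|exact Hd|intros; apply Rmult_comm].
  auto_derive; [exact I|ring].
Qed.

(** The last factor s + 2m - 1 is split off. Because it is zero at 1 - 2m, the derivative of the
    Taylor tail there involves only the value of the cofactor. *)
Lemma poch_vanishing (m : nat) (s : R) : (1 <= m)%nat ->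
  poch s (2 * m) = (s - neg_odd m) * poch s (pred (2 * m)).
Proof.
  intros Hm. destruct (2 * m)%nat as [|n] eqn:E; [lia|]. simpl.
  assert (E' : INR (2 * m) = INR (S n)) by now rewrite E.
  rewrite mult_INR, (S_INR n) in E'. simpl (INR 2) in E'. unfold neg_odd.
  replace (INR n) with (2 * INR m - 1) by lra. ring.
Qed.

Lemma neg_odd_lower (m : nat) : - INR (2 * m) < neg_odd m.
Proof. unfold neg_odd. rewrite mult_INR. simpl (INR 2). lra. Qed.

Lemma neg_odd_neq_1 (m : nat) : (1 <= m)%nat -> neg_odd m <> 1.
Proof. intros Hm. unfold neg_odd. assert (1 <= INR m) by (apply (le_INR 1); exact Hm). lra. Qed.

(** Beyond index 2m each coefficient is s - (1 - 2m) times a differentiable cofactor, so its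
    derivative is that cofactor. This matches the derivatives with the terms of the tail without
    differentiating a series term by term. *)
Lemma tail_coef_at_neg_odd (Z : R -> R -> R) (HZ : is_HurwitzZeta Z) (m n : nat) : (1 <= m)%nat ->
  taylor_value Z m (S (2 * m) + n) = 0 /\
  taylor_deriv Z m (S (2 * m) + n) = poch (neg_odd m) (pred (2 * m)) *
   (((-1) ^ (S (2 * m) + n) - 1) / INR (fact (S (2 * m) + n)) *
    (poch (neg_odd m + INR (2 * m)) (S n) * Z (neg_odd m + INR (S (2 * m) + n)) 1)).
Proof.
  intros Hm. set (N := (2 * m)%nat). split.
  - unfold taylor_value. rewrite odd_taylor_coef_tail. unfold N. rewrite poch_vanishing by exact Hm. ring.
  - unfold taylor_deriv. apply is_derive_unique.
    set (h := fun s => poch s (pred N) * (((-1) ^ (S N + n) - 1) / INR (fact (S N + n)) *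
        (poch (s + INR N) (S n) * Z (s + INR (S N + n)) 1))).
    apply is_derive_ext with (fun s => (s - neg_odd m) * h s).
    + intros s. rewrite odd_taylor_coef_tail, (poch_vanishing m s Hm : poch s N = _).
      unfold h, N. eqR. ring.
    + apply (is_derive_mul_vanishing h). unfold h.
      apply (ex_derive_mult (fun s => poch s (pred N))); [apply ex_derive_poch|].
      apply (ex_derive_scal (fun s => poch (s + INR N) (S n) * Z (s + INR (S N + n)) 1)).
      apply (ex_derive_mult (fun s => poch (s + INR N) (S n))).
      * apply (ex_derive_comp (fun s => poch s (S n)) (fun s => s + INR N)); [apply ex_derive_poch|].
        auto_derive. exact I.
      * apply (ex_derive_comp (fun t => Z t 1) (fun s => s + INR (S N + n))).
        -- apply ex_derive_hurwitz; [exact HZ|lra|].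
           pose proof (neg_odd_lower m). fold N in H. rewrite plus_INR, S_INR. pose proof (pos_INR n). lra.
        -- auto_derive. exact I.
Qed.

Lemma odd_zeta_deriv_local (Z : R -> R -> R) (HZ : is_HurwitzZeta Z) (m : nat) (a : R) :
  (1 <= m)%nat -> 0 < a < 1 ->
  locally (neg_odd m) (fun s => Rpower a (- s) +
    (sum_n (fun j => odd_taylor_coef Z j s * a ^ j) (2 * m) +
     (s - neg_odd m) * (poch s (pred (2 * m)) * odd_taylor_tail Z (2 * m) a s)) = Z s a - Z s (1 - a)).
Proof.
  intros Hm Ha. apply filter_imp with (2 := neg_odd_near_pole m Hm).
  intros s (H1 & H2 & H3).
  rewrite (hurwitz_shift Z HZ s a) by lra.
  pose proof (odd_taylor_continuation Z HZ (2 * m) s a Ha H1 H2 H3) as E.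
  rewrite poch_vanishing in E by exact Hm. lra.
Qed.

Lemma is_derive_sum_n_R (f : nat -> R -> R) (df : nat -> R) (n : nat) (x : R) :
  (forall k, is_derive (f k) x (df k)) ->
  is_derive (fun y => sum_n (fun k => f k y) n) x (sum_n df n).
Proof.
  intros H. induction n as [|n IH].
  - rewrite sum_O. apply is_derive_ext with (f O); [intros; now rewrite sum_O|apply H].
  - rewrite sum_Sn. apply is_derive_ext with (fun y => plus (sum_n (fun k => f k y) n) (f (S n) y)).
    + intros; now rewrite sum_Sn.
    + apply (is_derive_plus (fun y => sum_n (fun k => f k y) n)); [exact IH|apply H].
Qed.

Lemma Rpower_neg_odd (m : nat) (a : R) : (1 <= m)%nat -> 0 < a -> Rpower a (- neg_odd m) = a ^ (2 * m - 1).
Proof.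
  intros Hm Ha. rewrite <- Rpower_pow by exact Ha. f_equal. unfold neg_odd.
  rewrite minus_INR by lia. rewrite mult_INR. simpl. ring.
Qed.

Lemma is_series_taylor_deriv (Z : R -> R -> R) (HZ : is_HurwitzZeta Z) (m : nat) (a : R) :
  (1 <= m)%nat -> 0 < a < 1 ->
  is_series (fun j => taylor_deriv Z m j * a ^ j) (odd_zeta_deriv Z m a + ln a * a ^ (2 * m - 1)).
Proof.
  intros Hm Ha.
  set (N := (2 * m)%nat). set (Q := fun s => poch s (pred N) * odd_taylor_tail Z N a s).
  assert (HD : is_derive (fun s => Z s a - Z s (1 - a)) (neg_odd m)
     (- ln a * a ^ (2 * m - 1) + (sum_n (fun j => taylor_deriv Z m j * a ^ j) N + Q (neg_odd m)))).
  { apply is_derive_ext_loc with (1 := odd_zeta_deriv_local Z HZ m a Hm Ha).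
    apply (is_derive_plus (fun s => Rpower a (- s))).
    - rewrite <- Rpower_neg_odd by (try exact Hm; lra).
      unfold Rpower. auto_derive; [exact I|ring].
    - apply (is_derive_plus (fun s => sum_n (fun j => odd_taylor_coef Z j s * a ^ j) (2 * m))).
      + apply (is_derive_sum_n_R (fun j s => odd_taylor_coef Z j s * a ^ j)).
        intros j.
        apply is_derive_ext with (fun s => a ^ j * odd_taylor_coef Z j s).
        { intros; apply Rmult_comm. }
        apply is_derive_eq with (a ^ j * taylor_deriv Z m j); [apply Rmult_comm|].
        apply (is_derive_scal (odd_taylor_coef Z j)).
        apply Derive_correct, ex_derive_odd_taylor_coef; [exact HZ|apply neg_odd_pole].
      + apply (is_derive_mul_vanishing Q). unfold Q.
        apply (ex_derive_mult (fun s => poch s (pred N))); [apply ex_derive_poch|].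
        apply analytic_at_ex_derive, odd_taylor_tail_analytic; [exact HZ|exact Ha|apply neg_odd_lower]. }
  assert (ED : odd_zeta_deriv Z m a + ln a * a ^ (2 * m - 1) = sum_n (fun j => taylor_deriv Z m j * a ^ j) N + Q (neg_odd m)).
  { pose proof (is_derive_unique _ _ _ HD) as E.
    rewrite Derive_minus in E by (apply ex_derive_hurwitz; [exact HZ|lra|now apply neg_odd_neq_1]).
    change (odd_zeta_deriv Z m a = - ln a * a ^ (2 * m - 1) + (sum_n (fun j => taylor_deriv Z m j * a ^ j) N + Q (neg_odd m))) in E.
    rewrite E. ring. }
  apply (is_series_eq (fun j => taylor_deriv Z m j * a ^ j) _ (sum_n (fun j => taylor_deriv Z m j * a ^ j) N + Q (neg_odd m)));
    [reflexivity|symmetry; exact ED|].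
  (* The value [Q (neg_odd m)], which is the derivative of the whole tail, is also the sum of the
     derivatives of the single coefficients. *)
  assert (Ht : is_series (fun n => taylor_deriv Z m (S N + n) * a ^ (S N + n)) (Q (neg_odd m))).
  { apply (is_series_eq (fun n => poch (neg_odd m) (pred N) * odd_tail_term Z N a n (neg_odd m)) _ (Q (neg_odd m))).
    - intros n. destruct (tail_coef_at_neg_odd Z HZ m n Hm) as [_ E]. fold N in E. rewrite E.
      unfold odd_tail_term, Rdiv. ring.
    - reflexivity.
    - apply is_series_Rmult, Series_correct, ex_series_odd_tail_term; [exact HZ|exact Ha|apply neg_odd_lower]. }
  apply (is_series_decr_n _ (S N)); [lia|].
  eapply is_series_eq; [intros; reflexivity| |exact Ht].
  set (sN := sum_n (fun j => taylor_deriv Z m j * a ^ j) N).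
  change (Q (neg_odd m) = sN + Q (neg_odd m) + - sN). ring.
Qed.

Lemma taylor_value_sum (Z : R -> R -> R) (HZ : is_HurwitzZeta Z) (m : nat) :
  (1 <= m)%nat ->
  (1 / 2) ^ (2 * m - 1) + sum_n (fun j => taylor_value Z m j * (1 / 2) ^ j) (2 * m) = 0.
Proof.
  intros Hm. pose proof (locally_singleton _ _ (odd_zeta_deriv_local Z HZ m (1 / 2) Hm ltac:(lra))) as E.
  cbv beta in E. rewrite Rpower_neg_odd in E by (try exact Hm; lra).
  replace (1 - 1 / 2) with (1 / 2) in E by field.
  rewrite (Rminus_diag_eq (neg_odd m)), Rmult_0_l, Rplus_0_r, Rminus_diag_eq in E by reflexivity.
  exact E.
Qed.

(** * Values of the Taylor coefficients at 1 - 2m *)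

Definition kronecker (k : nat) (c : R) (j : nat) : R := if Nat.eqb j k then c else 0.

Lemma sum_n_kronecker (k n : nat) (c : R) : (k <= n)%nat -> sum_n (kronecker k c) n = c.
Proof.
  intros Hk. assert (H0 : forall n, (n < k)%nat -> sum_n (kronecker k c) n = 0).
  { induction n0 as [|i IH]; intros Hi.
    - rewrite sum_O. unfold kronecker. destruct (Nat.eqb_spec 0 k); [lia|reflexivity].
    - rewrite sum_Sn, IH by lia. unfold kronecker. destruct (Nat.eqb_spec (S i) k); [lia|].
      unfold plus; simpl; ring. }
  induction n as [|n IH].
  - rewrite sum_O. unfold kronecker. destruct (Nat.eqb_spec 0 k); [reflexivity|lia].
  - rewrite sum_Sn. unfold plus; simpl. destruct (Nat.eq_dec k (S n)) as [->|Hne].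
    + rewrite H0 by lia. unfold kronecker. rewrite Nat.eqb_refl. ring.
    + rewrite IH by lia. unfold kronecker. destruct (Nat.eqb_spec (S n) k); [lia|ring].
Qed.

Lemma is_series_kronecker (k : nat) (c : R) : is_series (kronecker k c) c.
Proof.
  change (is_lim_seq (sum_n (kronecker k c)) c).
  apply is_lim_seq_ext_loc with (fun _ => c); [|apply is_lim_seq_const].
  exists k. intros n Hn. now rewrite sum_n_kronecker.
Qed.

Lemma taylor_value_rec (Z : R -> R -> R) (m j : nat) :
  INR (S j) * INR (S (S j)) * taylor_value Z (S m) (S (S j)) = neg_odd (S m) * (neg_odd (S m) + 1) * taylor_value Z m j.
Proof.
  unfold taylor_value. rewrite odd_taylor_coef_rec. do 2 f_equal. unfold neg_odd. rewrite S_INR. ring.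
Qed.

Lemma taylor_value_0 (Z : R -> R -> R) (m : nat) : taylor_value Z m 0 = 0.
Proof. apply odd_taylor_coef_even. now exists O. Qed.

(* Equivalently [Z (1 - 2m) a = Z (1 - 2m) (1 - a)], the parity of the Bernoulli polynomials; the linear coefficient is read off at [a = 1/2]. *)
Lemma taylor_value_eq (Z : R -> R -> R) (HZ : is_HurwitzZeta Z) (m : nat) :
  forall j, taylor_value Z (S m) j = kronecker (2 * m + 1) (-1) j.
Proof.
  assert (Hnz : forall j, INR (S j) * INR (S (S j)) <> 0).
  { intros j. apply Rmult_integral_contrapositive_currified; apply not_0_INR; lia. }
  induction m as [|m IH].
  (* The factor [neg_odd 1 + 1] of the recursion is zero, so nothing survives from index 2 on. *)
  - assert (H2 : forall j, taylor_value Z 1 (S (S j)) = 0).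
    { intros j. apply Rmult_eq_reg_l with (2 := Hnz j). rewrite taylor_value_rec.
      unfold neg_odd. simpl (INR 1). ring. }
    intros [|[|j]]; [apply taylor_value_0| |rewrite H2; reflexivity].
    pose proof (taylor_value_sum Z HZ 1 (le_n 1)) as E.
    change (2 * 1)%nat with 2%nat in E. rewrite !sum_Sn, sum_O, taylor_value_0, H2 in E.
    unfold plus in E; simpl in E. unfold kronecker; simpl. lra.
  - assert (H2 : forall j, taylor_value Z (S (S m)) (S (S j)) = kronecker (2 * m + 1) (-1) j).
    { intros j. apply Rmult_eq_reg_l with (2 := Hnz j). rewrite taylor_value_rec, IH.
      unfold kronecker. destruct (Nat.eqb_spec j (2 * m + 1)) as [->|_]; [|ring].
      unfold neg_odd. rewrite !S_INR, plus_INR, mult_INR. simpl. ring. }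
    intros [|[|j]].
    + rewrite taylor_value_0. unfold kronecker. destruct (Nat.eqb_spec 0 (2 * S m + 1)); [lia|reflexivity].
    + pose proof (taylor_value_sum Z HZ (S (S m)) ltac:(lia)) as E.
      rewrite (sum_n_ext _ (fun j => plus (kronecker 1 (taylor_value Z (S (S m)) 1 * (1 / 2)) j)
           (kronecker (2 * m + 3) (- (1 / 2) ^ (2 * m + 3)) j))) in E.
      * rewrite sum_n_plus, !sum_n_kronecker in E by lia. unfold plus in E; simpl plus in E.
        replace (2 * S (S m) - 1)%nat with (2 * m + 3)%nat in E by lia.
        simpl in E. unfold kronecker. destruct (Nat.eqb_spec 1 (2 * S m + 1)); [lia|]. lra.
      * intros [|[|j]]; match goal with |- _ = plus ?x ?y => change (plus x y) with (x + y) end.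
        -- rewrite taylor_value_0. unfold kronecker. destruct (Nat.eqb_spec 0 (2 * m + 3)); [lia|]. simpl. eqR. ring.
        -- unfold kronecker. destruct (Nat.eqb_spec 1 (2 * m + 3)); [lia|]. simpl. eqR. ring.
        -- rewrite H2. unfold kronecker. change (Nat.eqb (S (S j)) 1) with false. cbv iota.
           destruct (Nat.eqb_spec j (2 * m + 1)) as [Hj|Hj];
             destruct (Nat.eqb_spec (S (S j)) (2 * m + 3)) as [Hj'|Hj']; try lia.
           ++ rewrite Hj'. eqR. ring.
           ++ eqR. ring.
    + rewrite H2. unfold kronecker.
      destruct (Nat.eqb_spec j (2 * m + 1)); destruct (Nat.eqb_spec (S (S j)) (2 * S m + 1)); lia || reflexivity.
Qed.

Lemma taylor_deriv_0 (Z : R -> R -> R) (m : nat) : taylor_deriv Z m 0 = 0.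
Proof.
  unfold taylor_deriv. rewrite (Derive_ext _ (fun _ => 0)); [apply Derive_const|].
  intros s. apply odd_taylor_coef_even. now exists O.
Qed.

(** Derivative in s of the recursion for the coefficients. The product rule adds a term in the
    values; for arguments below 1 these form a single monomial, which will cancel the
    non-logarithmic part of the second derivative of [ln a] times a power. *)
Lemma taylor_deriv_rec (Z : R -> R -> R) (HZ : is_HurwitzZeta Z) (m j : nat) :
  (Nat.Odd j -> neg_odd (S m) + 2 + INR j <> 1) ->
  INR (S j) * INR (S (S j)) * taylor_deriv Z (S m) (S (S j)) =
  (2 * neg_odd (S m) + 1) * odd_taylor_coef Z j (neg_odd (S m) + 2) +
  neg_odd (S m) * (neg_odd (S m) + 1) * Derive (odd_taylor_coef Z j) (neg_odd (S m) + 2).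
Proof.
  intros Hj. unfold taylor_deriv. rewrite <- Derive_scal.
  rewrite (Derive_ext _ (fun s => s * (s + 1) * odd_taylor_coef Z j (s + 2)))
    by (intros; apply odd_taylor_coef_rec).
  apply is_derive_unique.
  apply (is_derive_mult (fun s => s * (s + 1)) (fun s => odd_taylor_coef Z j (s + 2)));
    [| |intros; apply Rmult_comm].
  - auto_derive; [exact I|ring].
  - apply is_derive_eq with (1 * Derive (odd_taylor_coef Z j) (neg_odd (S m) + 2)); [ring|].
    apply (is_derive_comp (odd_taylor_coef Z j) (fun s => s + 2)).
    + apply Derive_correct, ex_derive_odd_taylor_coef; assumption.
    + auto_derive; [exact I|ring].
Qed.

(** * Partial fractions of the cotangent *)

Lemma is_lim_seq_inv_INR_plus (c : R) : is_lim_seq (fun n => / (INR n + c)) 0.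
Proof.
  replace (Finite 0) with (Rbar_inv p_infty) by reflexivity.
  apply is_lim_seq_inv; [|discriminate].
  apply (is_lim_seq_plus INR (fun _ => c) p_infty c);
    [apply is_lim_seq_INR|apply is_lim_seq_const|reflexivity].
Qed.

Lemma ex_series_inv_sqr : ex_series (fun k => / (INR k + 1) ^ 2).
Proof.
  apply ex_series_Rabs_le with (fun k => 2 * (/ (INR k + 1) - / (INR (S k) + 1))).
  - intros k. pose proof (pos_INR k). rewrite S_INR.
    rewrite Rabs_pos_eq by (apply Rlt_le, Rinv_0_lt_compat, pow_lt; lra).
    replace (2 * (/ (INR k + 1) - / (INR k + 1 + 1))) with (/ (INR k + 1) ^ 2 * (2 * (INR k + 1) / (INR k + 1 + 1)))
      by (field; lra).
    rewrite <- (Rmult_1_r (/ (INR k + 1) ^ 2)) at 1.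
    apply Rmult_le_compat_l; [apply Rlt_le, Rinv_0_lt_compat, pow_lt; lra|].
    apply Rmult_le_reg_r with (INR k + 1 + 1); [lra|]. field_simplify; lra.
  - apply (ex_series_scal 2 (fun k => / (INR k + 1) - / (INR (S k) + 1))). exists 1.
    change (is_lim_seq (sum_n (fun k => / (INR k + 1) - / (INR (S k) + 1))) 1).
    apply is_lim_seq_ext with (fun n => 1 - / (INR n + 2)).
    + induction n as [|n IH].
      * rewrite sum_O. simpl. field.
      * rewrite sum_Sn, <- IH. unfold plus; simpl plus. rewrite !S_INR.
        pose proof (pos_INR n). eqR. simpl. field. lra.
    + replace (Finite 1) with (Finite (1 - 0)) by (f_equal; ring).
      apply (is_lim_seq_minus' _ _ 1 0); [apply is_lim_seq_const|apply is_lim_seq_inv_INR_plus].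
Qed.

Definition cot_term (u : R) (k : nat) : R := / (INR k + 1 + u) - / (INR k + 1 - u).

(** The constant is 5 = 1 + 4: with y = k + 1 the products with plus signs are at least y^2, and
    those with minus signs at least y^2/4, since u and v are at most 1/2 <= y/2. *)
Lemma cot_term_diff (u v : R) (k : nat) : 0 <= u <= 1 / 2 -> 0 <= v <= 1 / 2 ->
  Rabs (cot_term u k - cot_term v k) <= 5 * Rabs (u - v) * / (INR k + 1) ^ 2.
Proof.
  intros Hu Hv. pose proof (pos_INR k). set (y := INR k + 1). unfold cot_term. fold y.
  assert (Hy : 1 <= y) by (unfold y; lra).
  replace (/ (y + u) - / (y - u) - (/ (y + v) - / (y - v))) with
    ((v - u) * (/ ((y + u) * (y + v)) + / ((y - u) * (y - v)))) by (field; lra).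
  rewrite Rabs_mult, (Rabs_minus_sym v u).
  assert (H1 : 0 < / ((y + u) * (y + v)) <= / y ^ 2).
  { split; [apply Rinv_0_lt_compat; nra|]. apply Rinv_le_contravar; nra. }
  assert (H2 : 0 < / ((y - u) * (y - v)) <= 4 * / y ^ 2).
  { split; [apply Rinv_0_lt_compat; nra|].
    replace (4 * / y ^ 2) with (/ (y ^ 2 / 4)) by (field; lra).
    apply Rinv_le_contravar; nra. }
  rewrite (Rabs_pos_eq (_ + _)) by lra.
  pose proof (Rabs_pos (u - v)). nra.
Qed.

Lemma ex_series_cot_term (u : R) : 0 <= u < 1 -> ex_series (cot_term u).
Proof.
  intros Hu. apply ex_series_Rabs_le with (fun k => 2 / (1 - u) * / (INR k + 1) ^ 2).
  - intros k. pose proof (pos_INR k). unfold cot_term. set (y := INR k + 1).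
    assert (Hy : 1 <= y) by (unfold y; lra).
    replace (/ (y + u) - / (y - u)) with (- (2 * u / ((y + u) * (y - u)))) by (field; lra).
    assert (Hd : y * (y * (1 - u)) <= (y + u) * (y - u)).
    { apply Rmult_le_compat; nra. }
    assert (Hp : 0 < y * (y * (1 - u))) by (apply Rmult_lt_0_compat; nra).
    rewrite Rabs_Ropp, Rabs_pos_eq.
    + replace (2 / (1 - u) * / y ^ 2) with (2 * / (y * (y * (1 - u)))) by (field; lra).
      unfold Rdiv. apply Rmult_le_compat; try lra.
      * apply Rlt_le, Rinv_0_lt_compat; lra.
      * now apply Rinv_le_contravar.
    + apply Rmult_le_pos; [lra|]. apply Rlt_le, Rinv_0_lt_compat; lra.
  - apply (ex_series_scal (2 / (1 - u)) (fun k => / (INR k + 1) ^ 2)), ex_series_inv_sqr.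
Qed.

Definition cot_sum (u : R) : R := / u + Series (cot_term u).

(** Regrouping the terms leaves a boundary term 1/(n + 1 + u) that tends to 0. The new grouping is
    the one adapted to halving the argument. *)
Lemma cot_sum_lim (u : R) : 0 < u < 1 ->
  is_lim_seq (sum_n (fun k => / (INR k + u) - / (INR k + 1 - u))) (cot_sum u).
Proof.
  intros Hu.
  apply is_lim_seq_ext with (fun n => / u + sum_n (cot_term u) n - / (INR n + (1 + u))).
  - induction n as [|n IH].
    + rewrite !sum_O. unfold cot_term. simpl. field. lra.
    + rewrite !sum_Sn, <- IH.
      change (/ u + (sum_n (cot_term u) n + cot_term u (S n)) - / (INR (S n) + (1 + u)) =
        / u + sum_n (cot_term u) n - / (INR n + (1 + u)) + (/ (INR (S n) + u) - / (INR (S n) + 1 - u))).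
      unfold cot_term. rewrite S_INR. pose proof (pos_INR n). field. lra.
  - unfold cot_sum. replace (Finite (/ u + Series (cot_term u))) with (Finite (/ u + Series (cot_term u) - 0))
      by (f_equal; ring).
    apply (is_lim_seq_minus' _ _ (/ u + Series (cot_term u)) 0); [|apply is_lim_seq_inv_INR_plus].
    apply (is_lim_seq_plus' _ _ (/ u) (Series (cot_term u))); [apply is_lim_seq_const|].
    apply (Series_correct (cot_term u)), ex_series_cot_term. lra.
Qed.

(** The first n + 1 terms of the two halved series recombine into the terms of index at most 2n + 1
    of the original one. For the cotangent this is cot y = (cot(y/2) - tan(y/2))/2, the tangent
    being the cotangent of the complement; with (1 - u)/2 both arguments stay in (0, 1/2] when u
    does. *)
Lemma cot_sum_duplication (u : R) : 0 < u < 1 ->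
  cot_sum u = (cot_sum (u / 2) - cot_sum ((1 - u) / 2)) / 2.
Proof.
  intros Hu.
  assert (H1 := cot_sum_lim u Hu).
  assert (H2 := cot_sum_lim (u / 2) ltac:(lra)). assert (H3 := cot_sum_lim ((1 - u) / 2) ltac:(lra)).
  assert (H4 : is_lim_seq (fun n => sum_n (fun k => / (INR k + u) - / (INR k + 1 - u)) (2 * n + 1)) (cot_sum u)).
  { apply (is_lim_seq_subseq _ _ (fun n => (2 * n + 1)%nat)) with (2 := H1).
    apply eventually_subseq. intros; lia. }
  assert (H5 := is_lim_seq_scal_r _ (/ 2) _ (is_lim_seq_minus' _ _ _ _ H2 H3)). simpl in H5.
  assert (E : Finite (cot_sum u) = Finite ((cot_sum (u / 2) - cot_sum ((1 - u) / 2)) * / 2)).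
  { rewrite <- (is_lim_seq_unique _ _ H4). apply is_lim_seq_unique.
    apply is_lim_seq_ext with (2 := H5). intros n. induction n as [|n IH].
    - change (2 * 0 + 1)%nat with 1%nat. rewrite sum_Sn, !sum_O. unfold plus; simpl. field. lra.
    - replace (2 * S n + 1)%nat with (S (S (2 * n + 1))) by lia. rewrite (sum_Sn _ (S _)), (sum_Sn _ (2 * n + 1)), <- IH, !sum_Sn.
      set (A := sum_n (fun k => / (INR k + u / 2) - / (INR k + 1 - u / 2)) n).
      set (B := sum_n (fun k => / (INR k + (1 - u) / 2) - / (INR k + 1 - (1 - u) / 2)) n).
      match goal with |- (plus ?a ?b - plus ?c ?d) * / 2 = plus (plus ?e ?f) ?g =>
        change ((a + b - (c + d)) * / 2 = e + f + g) end.
      rewrite !S_INR, plus_INR, mult_INR. simpl (INR 2). simpl (INR 1). pose proof (pos_INR n). field. lra. }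
  injection E. intros ->. reflexivity.
Qed.

Lemma x_cos_le_sin (y : R) : 0 <= y <= PI -> y * cos y <= sin y.
Proof.
  intros Hy. destruct (Req_dec y 0) as [->|Hne]; [rewrite sin_0; lra|].
  destruct (MVT_gen (fun t => sin t - t * cos t) 0 y (fun t => t * sin t)) as (c & Hc & E).
  - intros t _. auto_derive; [exact I|ring].
  - intros t _. apply continuity_pt_filterlim.
    apply (ex_derive_continuous (fun t => sin t - t * cos t)). auto_derive. exact I.
  - rewrite Rmin_left, Rmax_right in Hc by lra. rewrite sin_0 in E.
    assert (0 <= c * sin c) by (apply Rmult_le_pos; [lra|apply sin_ge_0; lra]). nra.
Qed.

(** The derivative 1/sin^2 - 1/t^2 lies between 0 and 1: the lower bound is sin t <= t, and the
    upper one amounts to t^2 cos^2 t <= sin^2 t, which is [x_cos_le_sin] squared. Subtracting 1/t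
    removes the singularity of the cotangent at 0. *)
Lemma inv_sub_cot_lipschitz (x y : R) : 0 < x <= PI / 2 -> 0 < y <= PI / 2 ->
  Rabs ((/ x - cos x / sin x) - (/ y - cos y / sin y)) <= Rabs (x - y).
Proof.
  intros Hx Hy. pose proof PI_RGT_0.
  destruct (MVT_gen (fun t => / t - cos t / sin t) y x (fun t => / (sin t) ^ 2 - / t ^ 2)) as (c & Hc & E).
  - intros t Ht.
    assert (Hm : 0 < Rmin y x) by (apply Rmin_pos; lra).
    assert (HM : Rmax y x <= PI / 2) by (apply Rmax_lub; lra).
    assert (0 < sin t) by (apply sin_gt_0; lra).
    auto_derive; [split; [lra|split; [lra|exact I]]|].
    pose proof (sin2_cos2 t) as S2. unfold Rsqr in S2.
    field_simplify; [|lra|lra]. f_equal.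
    replace (cos t ^ 2) with (1 - sin t ^ 2) by (simpl; lra). ring.
  - intros t Ht. apply continuity_pt_filterlim.
    assert (Hm : 0 < Rmin y x) by (apply Rmin_pos; lra).
    assert (HM : Rmax y x <= PI / 2) by (apply Rmax_lub; lra).
    assert (0 < sin t) by (apply sin_gt_0; lra).
    apply (ex_derive_continuous (fun t => / t - cos t / sin t)). auto_derive.
    split; [lra|split; [lra|exact I]].
  - assert (Hm : 0 < Rmin y x) by (apply Rmin_pos; lra).
    assert (HM : Rmax y x <= PI / 2) by (apply Rmax_lub; lra).
    assert (Hs : 0 < sin c) by (apply sin_gt_0; lra).
    assert (Hsx : sin c <= c) by (left; apply sin_lt_x; lra).
    assert (Hc0 : 0 <= cos c) by (apply cos_ge_0; lra).
    pose proof (x_cos_le_sin c ltac:(lra)) as Hxc.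
    pose proof (sin2_cos2 c) as S2. unfold Rsqr in S2.
    rewrite E, Rabs_mult. rewrite <- (Rmult_1_l (Rabs (x - y))) at 2.
    apply Rmult_le_compat_r; [apply Rabs_pos|].
    replace (/ sin c ^ 2 - / c ^ 2) with ((c ^ 2 - sin c ^ 2) / (sin c ^ 2 * c ^ 2)) by (field; lra).
    assert (Hd : 0 < sin c ^ 2 * c ^ 2) by (apply Rmult_lt_0_compat; apply pow_lt; lra).
    rewrite Rabs_pos_eq.
    + apply Rmult_le_reg_r with (1 := Hd). unfold Rdiv. rewrite Rmult_assoc, Rinv_l by lra.
      assert (0 <= c * cos c) by (apply Rmult_le_pos; lra).
      assert ((c * cos c) * (c * cos c) <= sin c * sin c) by (apply Rmult_le_compat; lra).
      simpl. nra.
    + apply Rmult_le_pos; [|apply Rlt_le, Rinv_0_lt_compat, Hd]. simpl. nra.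
Qed.

(* The defect satisfies [g u = (g (u / 2) - g ((1 - u) / 2)) / 2], so a Lipschitz constant of [g] can be halved indefinitely. *)
Lemma cot_partial_fractions (u : R) : 0 < u <= 1 / 2 ->
  cot_sum u = PI * (cos (PI * u) / sin (PI * u)).
Proof.
  pose proof PI_RGT_0 as Hpi.
  set (g := fun u => cot_sum u - PI * (cos (PI * u) / sin (PI * u))).
  (* The first summand comes from [cot_term_diff]; in the second, one PI is the prefactor of the
     cotangent and the other the scaling of its argument. *)
  set (L := 5 * Series (fun k => / (INR k + 1) ^ 2) + PI * PI).
  assert (HL : forall u v, 0 < u <= 1 / 2 -> 0 < v <= 1 / 2 -> Rabs (g u - g v) <= L * Rabs (u - v)).
  { intros v w Hv Hw.
    replace (g v - g w) with ((Series (cot_term v) - Series (cot_term w)) +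
      PI * ((/ (PI * v) - cos (PI * v) / sin (PI * v)) - (/ (PI * w) - cos (PI * w) / sin (PI * w)))).
    - eapply Rle_trans; [apply Rabs_triang|]. unfold L. rewrite Rmult_plus_distr_r.
      apply Rplus_le_compat.
      + rewrite <- Series_minus by (apply ex_series_cot_term; lra).
        eapply Rle_trans; [apply Series_Rabs|].
        * apply ex_series_Rabs_le with (fun k => 5 * Rabs (v - w) * / (INR k + 1) ^ 2).
          -- intros k. rewrite Rabs_Rabsolu. apply cot_term_diff; lra.
          -- apply (ex_series_scal (5 * Rabs (v - w)) (fun k => / (INR k + 1) ^ 2)), ex_series_inv_sqr.
        * eapply Rle_trans; [apply (Series_le _ (fun k => 5 * Rabs (v - w) * / (INR k + 1) ^ 2))|].
          -- intros k. split; [apply Rabs_pos|]. apply cot_term_diff; lra.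
          -- apply (ex_series_scal (5 * Rabs (v - w)) (fun k => / (INR k + 1) ^ 2)), ex_series_inv_sqr.
          -- rewrite Series_scal_l. right. ring.
      + rewrite Rabs_mult, (Rabs_pos_eq PI), Rmult_assoc by lra. apply Rmult_le_compat_l; [lra|].
        eapply Rle_trans; [apply inv_sub_cot_lipschitz; nra|].
        rewrite <- Rmult_minus_distr_l, Rabs_mult, (Rabs_pos_eq PI); lra.
    - unfold g, cot_sum.
      assert (0 < sin (PI * v)) by (apply sin_gt_0; nra).
      assert (0 < sin (PI * w)) by (apply sin_gt_0; nra).
      field. lra. }
  assert (Hg : forall u, 0 < u <= 1 / 2 -> g u = (g (u / 2) - g ((1 - u) / 2)) / 2).
  { intros v Hv. unfold g. rewrite (cot_sum_duplication v) by lra.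
    assert (Hs : 0 < sin (PI * (v / 2))) by (apply sin_gt_0; nra).
    assert (Hc : 0 < cos (PI * (v / 2))) by (apply cos_gt_0; nra).
    replace (PI * ((1 - v) / 2)) with (PI / 2 - PI * (v / 2)) by field.
    rewrite cos_shift, sin_shift.
    replace (PI * v) with (2 * (PI * (v / 2))) by field. rewrite sin_2a, cos_2a. field. lra. }
  assert (Hn : forall n u v, 0 < u <= 1 / 2 -> 0 < v <= 1 / 2 -> Rabs (g u - g v) <= L / 2 ^ n * Rabs (u - v)).
  { induction n as [|n IH]; intros v w Hv Hw.
    - replace (L / 2 ^ 0) with L by (simpl; field). now apply HL.
    - rewrite (Hg v Hv), (Hg w Hw).
      replace ((g (v / 2) - g ((1 - v) / 2)) / 2 - (g (w / 2) - g ((1 - w) / 2)) / 2) with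
        (/ 2 * ((g (v / 2) - g (w / 2)) + (g ((1 - w) / 2) - g ((1 - v) / 2)))) by field.
      pose proof (IH (v / 2) (w / 2) ltac:(lra) ltac:(lra)) as I1.
      pose proof (IH ((1 - w) / 2) ((1 - v) / 2) ltac:(lra) ltac:(lra)) as I2.
      replace (v / 2 - w / 2) with (/ 2 * (v - w)) in I1 by field.
      replace ((1 - w) / 2 - (1 - v) / 2) with (/ 2 * (v - w)) in I2 by field.
      rewrite Rabs_mult, (Rabs_pos_eq (/ 2)) in * by lra.
      pose proof (Rabs_triang (g (v / 2) - g (w / 2)) (g ((1 - w) / 2) - g ((1 - v) / 2))).
      replace (L / 2 ^ S n) with (L / 2 ^ n * / 2); [|simpl; field; apply pow_nonzero; lra].
      set (q := L / 2 ^ n) in *. nra. }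
  intros Hu.
  assert (E0 : g u = 0).
  (* At u = 1/2 the two halved arguments both equal 1/4, so the functional equation gives the value
     0 against which every other value is compared. *)
  { assert (E1 : g (1 / 2) = 0).
    { rewrite Hg by lra. replace ((1 - 1 / 2) / 2) with (1 / 2 / 2) by field. lra. }
    assert (Hle : Rabs (g u) <= 0).
    { apply (is_lim_seq_le (fun _ => Rabs (g u)) (fun n => L * Rabs (u - 1 / 2) * (/ 2) ^ n) (Rabs (g u)) 0).
      - intros n. specialize (Hn n u (1 / 2) Hu ltac:(lra)). rewrite E1, Rminus_0_r in Hn.
        eapply Rle_trans; [exact Hn|]. right. rewrite pow_inv. unfold Rdiv. ring.
      - apply is_lim_seq_const.
      - replace (Finite 0) with (Rbar_mult (L * Rabs (u - 1 / 2)) 0) by (simpl; f_equal; ring).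
        apply is_lim_seq_scal_l, is_lim_seq_geom. rewrite Rabs_pos_eq; lra. }
    pose proof (Rabs_pos (g u)). apply Rabs_eq_0. lra. }
  unfold g in E0. lra.
Qed.

(** * The second-order recursion in the parameter *)

Lemma CV_radius_taylor_deriv (Z : R -> R -> R) (HZ : is_HurwitzZeta Z) (m : nat) (x : R) :
  (1 <= m)%nat -> Rabs x < 1 -> Rbar_lt (Rabs x) (CV_radius (taylor_deriv Z m)).
Proof.
  intros Hm Hx. pose proof (Rabs_pos x).
  apply CV_radius_gt with ((Rabs x + 1) / 2); [lra|].
  eexists. apply is_series_taylor_deriv; [exact HZ|exact Hm|lra].
Qed.

Lemma PSeries_is_series (c : nat -> R) (x l : R) :
  is_series (fun i => c i * x ^ i) l -> PSeries c x = l.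
Proof. apply is_series_unique. Qed.

Lemma odd_zeta_deriv_eq (Z : R -> R -> R) (HZ : is_HurwitzZeta Z) (k : nat) (a : R) : 0 < a < 1 ->
  odd_zeta_deriv Z (S k) a = PSeries (taylor_deriv Z (S k)) a - ln a * a ^ (2 * k + 1).
Proof.
  intros Ha. rewrite (PSeries_is_series _ _ _ (is_series_taylor_deriv Z HZ (S k) a ltac:(lia) Ha)).
  replace (2 * S k - 1)%nat with (2 * k + 1)%nat by lia. ring.
Qed.

Definition odd_zeta_deriv' (Z : R -> R -> R) (k : nat) (a : R) : R :=
  PSeries (PS_derive (taylor_deriv Z (S k))) a - (a ^ (2 * k) + INR (2 * k + 1) * (ln a * a ^ (2 * k))).

Lemma locally_between (x y z : R) : x < y < z -> locally y (fun t => x < t < z).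
Proof.
  intros H. apply filter_and; [now apply open_gt|now apply open_lt].
Qed.

Lemma is_derive_ln_pow (n : nat) (a : R) : 0 < a ->
  is_derive (fun t => ln t * t ^ S n) a (a ^ n + INR (S n) * (ln a * a ^ n)).
Proof.
  intros Ha. apply is_derive_eq with (/ a * a ^ S n + ln a * (INR (S n) * a ^ n)).
  - change (a ^ S n) with (a * a ^ n). field. lra.
  - apply (is_derive_mult ln (fun t => t ^ S n) a); [| |intros; apply Rmult_comm].
    + now apply is_derive_Reals, derivable_pt_lim_ln.
    + apply is_derive_Reals, derivable_pt_lim_pow.
Qed.

Lemma is_derive_odd_zeta_deriv (Z : R -> R -> R) (HZ : is_HurwitzZeta Z) (k : nat) (a : R) : 0 < a < 1 ->
  is_derive (odd_zeta_deriv Z (S k)) a (odd_zeta_deriv' Z k a).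
Proof.
  intros Ha.
  apply is_derive_ext_loc with (fun t => PSeries (taylor_deriv Z (S k)) t - ln t * t ^ (2 * k + 1)).
  - apply filter_imp with (2 := locally_between 0 a 1 Ha). intros t Ht. now rewrite odd_zeta_deriv_eq.
  - apply (is_derive_minus (PSeries (taylor_deriv Z (S k)))).
    + apply is_derive_PSeries, CV_radius_taylor_deriv; [exact HZ|lia|rewrite Rabs_pos_eq; lra].
    + rewrite Nat.add_1_r. apply is_derive_ln_pow. lra.
Qed.

Lemma is_derive_PSeries_taylor_deriv' (Z : R -> R -> R) (HZ : is_HurwitzZeta Z) (k : nat) (a : R) : 0 < a < 1 ->
  is_derive (PSeries (PS_derive (taylor_deriv Z (S k)))) a (PSeries (PS_derive (PS_derive (taylor_deriv Z (S k)))) a).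
Proof.
  intros Ha. apply is_derive_PSeries. rewrite CV_radius_derive.
  apply CV_radius_taylor_deriv; [exact HZ|lia|rewrite Rabs_pos_eq; lra].
Qed.

Lemma is_derive_odd_zeta_deriv'_S (Z : R -> R -> R) (HZ : is_HurwitzZeta Z) (l : nat) (a : R) : 0 < a < 1 ->
  is_derive (odd_zeta_deriv' Z (S l)) a (INR (2 * l + 3) * INR (2 * l + 2) * odd_zeta_deriv Z (S l) a).
Proof.
  intros Ha.
  assert (Es : neg_odd (S (S l)) + 2 = neg_odd (S l)) by (unfold neg_odd; rewrite !S_INR; ring).
  (* The recursion splits the series into a single monomial coming from the values and the series of
     [D] one level lower. The monomial, with coefficient 4l + 5, is what the second derivative of ln
     a * a^(2l+3) produces besides its logarithmic part. *)
  assert (E2 : PSeries (PS_derive (PS_derive (taylor_deriv Z (S (S l))))) a =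
    (2 * neg_odd (S (S l)) + 1) * - a ^ (2 * l + 1) +
    neg_odd (S (S l)) * (neg_odd (S (S l)) + 1) * (odd_zeta_deriv Z (S l) a + ln a * a ^ (2 * l + 1))).
  { apply PSeries_is_series.
    eapply (is_series_eq (fun j => (2 * neg_odd (S (S l)) + 1) * kronecker (2 * l + 1) (- a ^ (2 * l + 1)) j +
       neg_odd (S (S l)) * (neg_odd (S (S l)) + 1) * (taylor_deriv Z (S l) j * a ^ j))).
    - intros j. unfold PS_derive. rewrite <- (Rmult_assoc (INR (S j))), taylor_deriv_rec; [|exact HZ|].
      + rewrite Es. fold (taylor_value Z (S l) j) (taylor_deriv Z (S l) j). rewrite taylor_value_eq by exact HZ.
        unfold kronecker. destruct (Nat.eqb_spec j (2 * l + 1)) as [->|_]; ring.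
      + rewrite Es. apply neg_odd_pole.
    - reflexivity.
    - apply (is_series_plus (fun j => (2 * neg_odd (S (S l)) + 1) * kronecker (2 * l + 1) (- a ^ (2 * l + 1)) j)).
      + apply is_series_Rmult, is_series_kronecker.
      + apply is_series_Rmult. pose proof (is_series_taylor_deriv Z HZ (S l) a ltac:(lia) Ha) as H.
        now replace (2 * S l - 1)%nat with (2 * l + 1)%nat in H by lia. }
  unfold odd_zeta_deriv'.
  evar_last.
  - apply (is_derive_minus (PSeries (PS_derive (taylor_deriv Z (S (S l)))))); [now apply is_derive_PSeries_taylor_deriv'|].
    replace (2 * S l)%nat with (S (2 * l + 1)) by lia.
    apply (is_derive_plus (fun t => t ^ S (2 * l + 1))).
    + apply is_derive_Reals, derivable_pt_lim_pow.
    + apply (is_derive_scal (fun t => ln t * t ^ S (2 * l + 1))), is_derive_ln_pow. lra.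
  - rewrite E2. change (pred (S (2 * l + 1))) with (2 * l + 1)%nat.
    assert (E1 : INR (2 * l + 1) = 2 * INR l + 1) by (rewrite plus_INR, mult_INR; simpl; ring).
    replace (2 * l + 3)%nat with (S (S (2 * l + 1))) by lia.
    replace (2 * l + 2)%nat with (S (2 * l + 1)) by lia.
    replace (S (2 * l + 1) + 1)%nat with (S (S (2 * l + 1))) by lia.
    unfold neg_odd. rewrite !S_INR, !E1.
    match goal with |- minus ?A (plus ?B ?C) = ?D => change (A - (B + C) = D) end.
    eqR. ring.
Qed.

(** For m = 1 the recursion is evaluated at [neg_odd 1 + 2 = 1], and the factor [neg_odd 1 + 1 = 0]
    kills its derivative part. The coefficients left are multiples of zeta at j + 1; exchanging sums
    turns each k into the difference of two geometric series, 1/(y + a) - 1/(y - a) with y = k +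
    1. *)
Lemma PSeries_taylor_deriv_1'' (Z : R -> R -> R) (HZ : is_HurwitzZeta Z) (a : R) : 0 < a < 1 ->
  PSeries (PS_derive (PS_derive (taylor_deriv Z 1))) a = - Series (cot_term a).
Proof.
  intros Ha.
  assert (Hk : forall k, 1 <= INR k + 1) by (intros k; pose proof (pos_INR k); lra).
  destruct (HZ 1 Rlt_0_1) as [HZ1 _].
  set (c := fun k j => ((-1) ^ j - 1) * a ^ j / (INR k + 1) ^ S j).
  assert (eG : is_series (fun j => a ^ j) (/ (1 - a))) by (apply is_series_geom; rewrite Rabs_pos_eq; lra).
  assert (Hle : forall k j, 0 <= Rabs (c k j) <= 2 * / (INR k + 1) ^ 2 * a ^ j).
  { intros k j. split; [apply Rabs_pos|]. unfold c.
    assert (Hp : 0 < / (INR k + 1) ^ 2) by (apply Rinv_0_lt_compat, pow_lt; specialize (Hk k); lra).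
    assert (Hq : 0 < / (INR k + 1) ^ S j) by (apply Rinv_0_lt_compat, pow_lt; specialize (Hk k); lra).
    assert (Ha' : 0 < a ^ j) by (apply pow_lt; lra).
    (* The term j = 0 would be of size 1/(k + 1), not summable over k, but its parity factor is
       zero; every later term has a denominator of degree at least 2. *)
    destruct j as [|j].
    - simpl ((-1) ^ 0). unfold Rminus, Rdiv. rewrite Rplus_opp_r, !Rmult_0_l, Rabs_R0.
      apply Rmult_le_pos; lra.
    - unfold Rdiv. rewrite !Rabs_mult, (Rabs_pos_eq (a ^ _)), (Rabs_pos_eq (/ _)) by lra.
      assert (Hr : / (INR k + 1) ^ S (S j) <= / (INR k + 1) ^ 2).
      { apply Rinv_le_contravar; [apply pow_lt; specialize (Hk k); lra|].
        apply Rle_pow; [apply Hk|lia]. }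
      pose proof (Rabs_pow_m1_minus_1 (S j)). pose proof (Rabs_pos ((-1) ^ S j - 1)).
      rewrite Rmult_assoc, (Rmult_comm (a ^ S j)), <- Rmult_assoc.
      apply Rmult_le_compat_r; [lra|]. apply Rmult_le_compat; lra. }
  assert (eR : forall k, is_series (fun j => 2 * / (INR k + 1) ^ 2 * a ^ j) (2 * / (INR k + 1) ^ 2 * / (1 - a)))
    by (intros k; now apply is_series_Rmult).
  assert (Hrow : forall k, is_series (c k) (cot_term a k)).
  { intros k. unfold c, cot_term. set (y := INR k + 1). assert (Hy : 1 <= y) by apply Hk.
    assert (Hg : forall q, Rabs q < 1 -> is_series (fun j => / y * q ^ j) (/ y * / (1 - q)))
      by (intros q Hq; now apply is_series_Rmult, is_series_geom).
    assert (Hq : Rabs (a / y) < 1).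
    { assert (0 < a / y) by (apply Rdiv_lt_0_compat; lra). rewrite Rabs_pos_eq by lra.
      apply Rmult_lt_reg_r with y; [lra|]. unfold Rdiv. rewrite Rmult_assoc, Rinv_l; lra. }
    assert (Hq' : Rabs (- (a / y)) < 1) by now rewrite Rabs_Ropp.
    eapply is_series_eq; [| |exact (is_series_minus _ _ _ _ (Hg _ Hq') (Hg _ Hq))].
    - intros j. unfold minus, plus, opp; simpl.
      replace (- (a / y)) with (-1 * (a * / y)) by (unfold Rdiv; ring).
      unfold Rdiv. rewrite !Rpow_mult_distr, Rinv_mult, !pow_inv. ring.
    - unfold minus, plus, opp; simpl. field. lra. }
  assert (HS := series_swap c (fun k => 2 * / (INR k + 1) ^ 2 * / (1 - a))).
  assert (HS' : is_series (fun j => Series (fun k => c k j)) (Series (cot_term a))).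
  { eapply is_series_eq; [reflexivity| |apply HS].
    - apply Series_ext. intros k. apply is_series_unique, Hrow.
    - intros k. apply ex_series_Rabs_le with (2 := ex_intro _ _ (eR k)).
      intros j. rewrite Rabs_Rabsolu. apply Hle.
    - intros k. rewrite <- (is_series_unique _ _ (eR k)). apply Series_le; [apply Hle|eexists; apply eR].
    - apply (ex_series_scal_r (/ (1 - a)) (fun k => 2 * / (INR k + 1) ^ 2)).
      apply (ex_series_scal 2 (fun k => / (INR k + 1) ^ 2)), ex_series_inv_sqr. }
  apply PSeries_is_series.
  eapply is_series_eq; [| |exact (is_series_Rmult (-1) _ _ HS')]; [|ring].
  assert (Es : neg_odd 1 + 2 = 1) by (unfold neg_odd; simpl; ring).
  intros j. unfold PS_derive. rewrite <- (Rmult_assoc (INR (S j))), taylor_deriv_rec; [|exact HZ|].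
  - rewrite Es. replace (neg_odd 1) with (-1) by (unfold neg_odd; simpl; ring).
    destruct j as [|j].
    + rewrite !odd_taylor_coef_even by (now exists O). unfold c. simpl.
      rewrite (Series_ext _ (fun _ => 0)) by (intros; unfold Rdiv; ring).
      rewrite (is_series_unique _ _ is_series_zero). ring.
    + replace (Series (fun k => c k (S j))) with (((-1) ^ S j - 1) * a ^ S j * Z (1 + INR (S j)) 1).
      * unfold odd_taylor_coef, binom_coef.
        assert (Hp : forall n, poch 1 n = INR (fact n)).
        { induction n as [|n IH]; [reflexivity|]. simpl poch. rewrite IH, fact_simpl, mult_INR, S_INR. ring. }
        rewrite Hp. field. apply INR_fact_neq_0.
      * unfold c, Rdiv. rewrite Series_scal_l. f_equal. symmetry. apply is_series_unique.
        eapply is_series_eq; [|reflexivity|apply HZ1].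
        -- intros k. cbv beta. rewrite Rpower_Ropp.
           replace (1 + INR (S j)) with (INR (S (S j))) by (rewrite (S_INR (S j)); ring).
           rewrite Rpower_pow; [reflexivity|]. specialize (Hk k). lra.
        -- rewrite S_INR. pose proof (pos_INR j). lra.
  - rewrite Es. intros [i ->] H. rewrite plus_INR, mult_INR in H. simpl in H.
    pose proof (pos_INR i). lra.
Qed.

Lemma is_derive_odd_zeta_deriv'_0 (Z : R -> R -> R) (HZ : is_HurwitzZeta Z) (a : R) : 0 < a <= 1 / 2 ->
  is_derive (odd_zeta_deriv' Z 0) a (- (PI * (cos (PI * a) / sin (PI * a)))).
Proof.
  intros Ha. rewrite <- cot_partial_fractions by exact Ha.
  unfold odd_zeta_deriv', cot_sum. evar_last.
  - apply (is_derive_minus (PSeries (PS_derive (taylor_deriv Z 1)))); [apply is_derive_PSeries_taylor_deriv'; [exact HZ|lra]|].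
    apply is_derive_ext with (fun t => 1 + 1 * (ln t * 1)); [reflexivity|].
    auto_derive; [lra|reflexivity].
  - rewrite PSeries_taylor_deriv_1'' by (try exact HZ; lra). unfold minus, plus, opp; simpl. field. lra.
Qed.

(** The inequality ln t <= t - 1 is applied at t = 1/sqrt a: at t = 1/a it would give only a bounded
    product, not one tending to 0. *)
Lemma abs_mul_ln_le (a : R) : 0 < a <= 1 -> Rabs (a * ln a) <= 2 * sqrt a.
Proof.
  intros Ha. assert (Hs : 0 < sqrt a) by (apply sqrt_lt_R0; lra).
  assert (Hl : - ln (sqrt a) <= / sqrt a - 1).
  { rewrite <- ln_Rinv by exact Hs. pose proof (exp_ineq1_le (ln (/ sqrt a))) as H.
    rewrite exp_ln in H by now apply Rinv_0_lt_compat. lra. }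
  assert (Es : sqrt a * sqrt a = a) by (apply sqrt_sqrt; lra).
  assert (El : ln a = 2 * ln (sqrt a)) by (rewrite <- Es at 1; rewrite ln_mult by exact Hs; ring).
  assert (ln a <= 0) by (rewrite <- ln_1; apply ln_le; lra).
  rewrite Rabs_left1 by nra. rewrite El.
  replace (- (a * (2 * ln (sqrt a)))) with (2 * sqrt a * (sqrt a * - ln (sqrt a)))
    by (transitivity (- (sqrt a * sqrt a * (2 * ln (sqrt a)))); [ring|now rewrite Es]).
  rewrite <- (Rmult_1_r (2 * sqrt a)) at 2. apply Rmult_le_compat_l; [lra|].
  apply Rle_trans with (sqrt a * (/ sqrt a - 1)); [apply Rmult_le_compat_l; lra|].
  rewrite Rmult_minus_distr_l, Rinv_r; lra.
Qed.

Lemma odd_zeta_deriv_lim_0 (Z : R -> R -> R) (HZ : is_HurwitzZeta Z) (k : nat) :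
  filterlim (odd_zeta_deriv Z (S k)) (at_right 0) (locally 0).
Proof.
  assert (Hloc : at_right 0 (fun a => 0 < a < 1)).
  { exists (mkposreal 1 Rlt_0_1). intros y Hy Hy0. split; [exact Hy0|].
    unfold ball in Hy; simpl in Hy; unfold AbsRing_ball, abs, minus, plus, opp in Hy; simpl in Hy.
    apply Rabs_def2 in Hy. lra. }
  apply filterlim_ext_loc with (fun a => PSeries (taylor_deriv Z (S k)) a + - (ln a * a ^ (2 * k + 1))).
  { apply filter_imp with (2 := Hloc). intros a Ha. rewrite odd_zeta_deriv_eq by assumption. reflexivity. }
  replace 0 with (PSeries (taylor_deriv Z (S k)) 0 + 0) at 2
    by (rewrite PSeries_0, taylor_deriv_0; ring).
  apply (filterlim_comp_2 (G := locally (PSeries (taylor_deriv Z (S k)) 0)) (H := locally 0)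
    (PSeries (taylor_deriv Z (S k))) (fun a => - (ln a * a ^ (2 * k + 1))) Rplus).
  - eapply filterlim_filter_le_1; [apply filter_le_within|].
    apply (ex_derive_continuous (PSeries (taylor_deriv Z (S k)))), ex_derive_PSeries, CV_radius_taylor_deriv; [exact HZ|lia|].
    rewrite Rabs_R0. lra.
  - apply filterlim_locally. intros eps.
    assert (Hc : filterlim (fun a => 2 * sqrt a) (at_right 0) (locally 0)).
    { eapply filterlim_filter_le_1; [apply filter_le_within|].
      replace 0 with (2 * sqrt 0) at 2 by (rewrite sqrt_0; ring).
      apply (continuous_mult (fun _ => 2) sqrt); [apply continuous_const|apply continuous_sqrt]. }
    assert (Hb := proj1 (filterlim_locally _ _) Hc eps).
    apply filter_imp with (2 := filter_and _ _ Hb Hloc). intros a [H1 Ha].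
    unfold ball in *; simpl in *; unfold AbsRing_ball, abs, minus, plus, opp in *; simpl in *.
    eapply Rle_lt_trans; [|exact H1].
    rewrite Ropp_0, !Rplus_0_r, Rabs_Ropp.
    rewrite (Rabs_pos_eq (2 * sqrt a)) by (pose proof (sqrt_pos a); lra).
    eapply Rle_trans; [|apply abs_mul_ln_le; lra].
    change (k + (k + 0))%nat with (2 * k)%nat. rewrite Nat.add_1_r.
    change (a ^ S (2 * k)) with (a * a ^ (2 * k)).
    replace (ln a * (a * a ^ (2 * k))) with (a * ln a * a ^ (2 * k)) by ring.
    rewrite Rabs_mult. rewrite <- (Rmult_1_r (Rabs (a * ln a))) at 2.
    apply Rmult_le_compat_l; [apply Rabs_pos|].
    rewrite Rabs_pos_eq by (apply pow_le; lra).
    rewrite <- (pow1 (2 * k)). apply pow_incr. lra.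
  - apply (filterlim_plus (V := R_NormedModule) (PSeries (taylor_deriv Z (S k)) 0) 0).
Qed.

(** * Comparison with the trigonometric series *)

(** The limit [E] need not be known to be differentiable. Its approximants have zero slope at 0 and
    second derivatives tending to 0 uniformly on each smaller interval, so two mean value estimates
    bound |f n x - f n 0| by d n * b^2. The approximants may be partial sums or averages of them. *)
Lemma limit_of_flattening (B : R) (E : R -> R) (f f1 f2 : nat -> R -> R) :
  (forall n x, Rabs x < B -> is_derive (f n) x (f1 n x)) ->
  (forall n x, Rabs x < B -> is_derive (f1 n) x (f2 n x)) ->
  (forall n, f1 n 0 = 0) ->
  (forall b, 0 < b < B -> exists d : nat -> R, is_lim_seq d 0 /\
     forall n x, Rabs x <= b -> Rabs (f2 n x) <= d n) ->
  (forall x, Rabs x < B -> is_lim_seq (fun n => f n x) (E x)) ->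
  forall x, Rabs x < B -> E x = E 0.
Proof.
  intros H1 H2 H0 Hd HE x Hx.
  destruct (Req_dec x 0) as [->|Hne]; [reflexivity|].
  set (b := Rabs x) in *. assert (Hb : 0 < b) by now apply Rabs_pos_lt.
  destruct (Hd b (conj Hb Hx)) as (d & Ld & Hd').
  assert (B1 : forall n y, Rabs y <= b -> Rabs (f1 n y) <= d n * b).
  { intros n y Hy.
    assert (Hdn : 0 <= d n) by (eapply Rle_trans; [apply Rabs_pos|apply (Hd' n 0); rewrite Rabs_R0; lra]).
    apply Rle_trans with (d n * Rabs (y - 0)).
    - replace (f1 n y) with (f1 n y - f1 n 0) by (rewrite H0; ring).
      apply (bounded_variation (f1 n) (f2 n)). intros t Ht. rewrite !Rminus_0_r in Ht.
      split; [apply H2|apply Hd']; lra.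
    - rewrite Rminus_0_r. apply Rmult_le_compat_l; assumption. }
  assert (B0 : forall n, Rabs (f n x - f n 0) <= d n * b * b).
  { intros n. replace (d n * b * b) with (d n * b * Rabs (x - 0)) by (rewrite Rminus_0_r; reflexivity).
    apply (bounded_variation (f n) (f1 n)). intros t Ht. rewrite !Rminus_0_r in Ht. fold b in Ht.
    split; [apply H1|apply B1]; lra. }
  assert (HB0 : Rabs 0 < B) by (rewrite Rabs_R0; lra).
  assert (HL : Rabs (E x - E 0) <= 0).
  { apply (is_lim_seq_le (fun n => Rabs (f n x - f n 0)) (fun n => d n * (b * b)) (Rabs (E x - E 0)) 0).
    - intros n. rewrite <- Rmult_assoc. apply B0.
    - apply (is_lim_seq_abs _ (E x - E 0)).
      apply (is_lim_seq_minus' _ _ (E x) (E 0)); now apply HE.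
    - replace (Finite 0) with (Rbar_mult 0 (b * b)) by (simpl; f_equal; ring).
      now apply is_lim_seq_scal_r. }
  pose proof (Rabs_pos (E x - E 0)). apply Rminus_diag_uniq, Rabs_eq_0. lra.
Qed.

(** * Partial sums of the trigonometric series and their averages *)

Definition osc (m n : nat) (x : R) : R :=
  (-1) ^ n * cos ((2 * INR n + 1) * x) / (2 * INR n + 1) ^ (2 * m).
Definition osc' (m n : nat) (x : R) : R :=
  - ((-1) ^ n * sin ((2 * INR n + 1) * x) * (2 * INR n + 1)) / (2 * INR n + 1) ^ (2 * m).
Definition osum (m N : nat) (x : R) : R := sum_n (fun n => osc m n x) N.
Definition osum' (m N : nat) (x : R) : R := sum_n (fun n => osc' m n x) N.

Lemma odd_INR_pos (n : nat) : 1 <= 2 * INR n + 1.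
Proof. pose proof (pos_INR n). lra. Qed.

Lemma is_derive_osc (m n : nat) (x : R) : is_derive (osc m n) x (osc' m n x).
Proof.
  unfold osc, osc'.
  generalize (2 * INR n + 1) ((-1) ^ n) ((2 * INR n + 1) ^ (2 * m)). intros w e p.
  unfold Rdiv. auto_derive; [exact I|]. ring.
Qed.

Lemma is_derive_osc' (k n : nat) (x : R) : is_derive (osc' (S k) n) x (- osc k n x).
Proof.
  pose proof (odd_INR_pos n) as Hw. unfold osc, osc'.
  replace (2 * S k)%nat with (2 * k + 2)%nat by lia. rewrite pow_add.
  assert (Hp : (2 * INR n + 1) ^ (2 * k) <> 0) by (apply pow_nonzero; lra).
  revert Hw Hp. generalize (2 * INR n + 1) ((-1) ^ n) ((2 * INR n + 1) ^ (2 * k)). intros w e p Hw Hp.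
  auto_derive; [exact I|]. field. split; [exact Hp|lra].
Qed.

Lemma sum_n_opp_R (u : nat -> R) (n : nat) : sum_n (fun k => - u k) n = - sum_n u n.
Proof.
  induction n as [|n IH]; [now rewrite !sum_O|].
  rewrite !sum_Sn, IH. unfold plus; simpl. ring.
Qed.

Lemma is_derive_osum (m N : nat) (x : R) : is_derive (osum m N) x (osum' m N x).
Proof. apply (is_derive_sum_n_R (osc m)). intros n. apply is_derive_osc. Qed.

Lemma is_derive_osum' (k N : nat) (x : R) : is_derive (osum' (S k) N) x (- osum k N x).
Proof.
  unfold osum. rewrite <- sum_n_opp_R.
  apply (is_derive_sum_n_R (osc' (S k)) (fun n => - osc k n x)). intros n. apply is_derive_osc'.
Qed.

Lemma osum'_0 (m N : nat) : osum' m N 0 = 0.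
Proof.
  unfold osum'. rewrite (sum_n_ext _ (fun _ => 0)).
  - rewrite sum_n_const. ring.
  - intros n. unfold osc'. rewrite Rmult_0_r, sin_0. unfold Rdiv. eqR. ring.
Qed.

Lemma osc_bound (k n : nat) (x : R) : Rabs (osc (S k) n x) <= / (INR n + 1) ^ 2.
Proof.
  pose proof (pos_INR n) as Hn. pose proof (odd_INR_pos n) as Hw.
  unfold osc, Rdiv. rewrite !Rabs_mult, pow_1_abs, Rmult_1_l, Rabs_inv.
  rewrite (Rabs_pos_eq (_ ^ _)) by (apply pow_le; lra).
  rewrite <- (Rmult_1_l (/ (INR n + 1) ^ 2)).
  apply Rmult_le_compat; [apply Rabs_pos|apply Rlt_le, Rinv_0_lt_compat, pow_lt; lra| |].
  - apply Rabs_le, COS_bound.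
  - apply Rinv_le_contravar; [apply pow_lt; lra|].
    apply Rle_trans with ((2 * INR n + 1) ^ 2); [apply pow_incr; lra|].
    apply Rle_pow; [exact Hw|lia].
Qed.

Lemma ex_series_osc (k : nat) (x : R) : ex_series (fun n => osc (S k) n x).
Proof.
  apply ex_series_Rabs_le with (2 := ex_series_inv_sqr). intros n. apply osc_bound.
Qed.

Definition osc_series (k : nat) (x : R) : R := Series (fun n => osc (S k) n x).

Lemma osum_lim (k : nat) (x : R) : is_lim_seq (fun N => osum (S k) N x) (osc_series k x).
Proof. apply (Series_correct (fun n => osc (S k) n x)), ex_series_osc. Qed.

Lemma osum_uniform (k N : nat) (x : R) :
  Rabs (osc_series k x - osum (S k) N x) <=
  Series (fun n => / (INR n + 1) ^ 2) - sum_n (fun n => / (INR n + 1) ^ 2) N.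
Proof.
  pose proof ex_series_inv_sqr as He.
  unfold osc_series, osum.
  rewrite (Series_incr_n _ (S N)) by (try lia; apply ex_series_osc).
  rewrite (Series_incr_n (fun n => / (INR n + 1) ^ 2) (S N)) by (try lia; exact He).
  simpl pred. rewrite !sum_n_Reals.
  match goal with |- Rabs (?a + ?b - ?a) <= ?c + ?d - ?c =>
    replace (a + b - a) with b by ring; replace (c + d - c) with d by ring end.
  assert (He' : ex_series (fun i => / (INR (S N + i) + 1) ^ 2))
    by (apply (ex_series_incr_n (fun n => / (INR n + 1) ^ 2)); exact He).
  eapply Rle_trans; [apply Series_Rabs|].
  - apply ex_series_Rabs_le with (2 := He'). intros n. rewrite Rabs_Rabsolu. apply osc_bound.
  - apply Series_le; [|exact He']. intros n. split; [apply Rabs_pos|apply osc_bound].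
Qed.

(** Multiplying by 2 cos x telescopes: 2 cos x cos((2n+1)x) = cos((2n+2)x) + cos(2nx), with
    alternating signs. The oscillating term left over need not tend to 0, hence the averaging. *)
Lemma osum_0_closed (N : nat) (x : R) : cos x <> 0 ->
  osum 0 N x = (1 + (-1) ^ N * cos ((2 * INR N + 2) * x)) / (2 * cos x).
Proof.
  intros Hc. unfold osum. induction N as [|N IH].
  - rewrite sum_O. unfold osc. simpl.
    replace ((2 * 0 + 2) * x) with (2 * x) by ring. replace ((2 * 0 + 1) * x) with x by ring.
    rewrite cos_2a_cos. field. exact Hc.
  - rewrite sum_Sn, IH. match goal with |- plus ?a ?b = ?c => change (a + b = c) end.
    unfold osc. change (2 * 0)%nat with 0%nat.
    rewrite S_INR.
    replace ((2 * (INR N + 1) + 2) * x) with ((2 * (INR N + 1) + 1) * x + x) by ring.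
    replace ((2 * INR N + 2) * x) with ((2 * (INR N + 1) + 1) * x - x) by ring.
    rewrite cos_plus, cos_minus. simpl pow. field. exact Hc.
Qed.

(** The same telescoping applied to the oscillating term: what is left stays bounded in n and
    disappears after division by n + 1. *)
Lemma sum_osum_0_closed (n : nat) (x : R) : cos x <> 0 ->
  sum_n (fun N => osum 0 N x) n =
  (INR n + 1 + (cos x + (-1) ^ n * cos ((2 * INR n + 3) * x)) / (2 * cos x)) / (2 * cos x).
Proof.
  intros Hc. induction n as [|n IH].
  - rewrite sum_O, osum_0_closed by exact Hc. simpl.
    replace ((2 * 0 + 3) * x) with (2 * x + x) by ring. replace ((2 * 0 + 2) * x) with (2 * x) by ring.
    rewrite cos_plus, sin_2a, cos_2a_cos.
    pose proof (sin2_cos2 x) as S2. unfold Rsqr in S2.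
    replace (2 * sin x * cos x * sin x) with (2 * cos x * (1 - cos x * cos x)) by (rewrite <- S2; ring).
    field. exact Hc.
  - rewrite sum_Sn, IH, osum_0_closed by exact Hc.
    match goal with |- plus ?a ?b = ?c => change (a + b = c) end.
    rewrite S_INR. set (y := (2 * (INR n + 1) + 2) * x).
    replace ((2 * INR n + 3) * x) with (y - x) by (unfold y; ring).
    replace ((2 * (INR n + 1) + 3) * x) with (y + x) by (unfold y; ring).
    rewrite cos_plus, cos_minus. simpl pow. field. exact Hc.
Qed.

Lemma cos_ge_of_Rabs (b x : R) : 0 < b < PI / 2 -> Rabs x <= b -> cos b <= cos x.
Proof.
  intros Hb Hx. pose proof PI_RGT_0.
  unfold Rabs in Hx. destruct (Rcase_abs x).
  - rewrite <- (cos_neg x). apply cos_decr_1; lra.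
  - apply cos_decr_1; lra.
Qed.

Lemma cesaro_osum_0 (b x : R) (n : nat) : 0 < b < PI / 2 -> Rabs x <= b ->
  Rabs (sum_n (fun N => osum 0 N x) n / (INR n + 1) - / (2 * cos x)) <=
  / (2 * (cos b) ^ 2) * / (INR n + 1).
Proof.
  intros Hb Hx. pose proof PI_RGT_0. pose proof (pos_INR n).
  assert (Hcb : 0 < cos b) by (apply cos_gt_0; lra).
  pose proof (cos_ge_of_Rabs b x Hb Hx) as Hc.
  rewrite sum_osum_0_closed by lra.
  set (r := cos x + (-1) ^ n * cos ((2 * INR n + 3) * x)).
  assert (Hr : Rabs r <= 2).
  { unfold r. eapply Rle_trans; [apply Rabs_triang|]. rewrite Rabs_mult, pow_1_abs.
    pose proof (Rabs_le (cos x) 1 (COS_bound x)).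
    pose proof (Rabs_le _ 1 (COS_bound ((2 * INR n + 3) * x))). lra. }
  replace ((INR n + 1 + r / (2 * cos x)) / (2 * cos x) / (INR n + 1) - / (2 * cos x))
    with (r * / (4 * cos x ^ 2) * / (INR n + 1)) by (field; lra).
  assert (Hp : 0 < 4 * cos b ^ 2) by (pose proof (pow_lt (cos b) 2 Hcb); lra).
  assert (Hle : 4 * cos b ^ 2 <= 4 * cos x ^ 2) by (apply Rmult_le_compat_l; [lra|apply pow_incr; lra]).
  assert (Hi : 0 < / (4 * cos x ^ 2)) by (apply Rinv_0_lt_compat; lra).
  assert (Hi' : / (4 * cos x ^ 2) <= / (4 * cos b ^ 2)) by (apply Rinv_le_contravar; lra).
  assert (Hn : 0 < / (INR n + 1)) by (apply Rinv_0_lt_compat; lra).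
  rewrite !Rabs_mult, (Rabs_pos_eq (/ (4 * _))), (Rabs_pos_eq (/ (INR n + 1))) by lra.
  replace (/ (2 * cos b ^ 2)) with (2 * / (4 * cos b ^ 2)) by (field; lra).
  apply Rmult_le_compat_r; [lra|]. apply Rmult_le_compat; try lra. apply Rabs_pos.
Qed.

Lemma is_lim_seq_cesaro (u : nat -> R) (l : R) :
  is_lim_seq u l -> is_lim_seq (fun n => sum_n u n / (INR n + 1)) l.
Proof.
  (* [Cesaro_1] divides the sum of the first n terms by n; the shift by one gives n + 1 terms over n
     + 1. *)
  intros H. apply is_lim_seq_Reals, Cesaro_1, is_lim_seq_Reals, is_lim_seq_incr_1 in H.
  apply is_lim_seq_ext with (2 := H). intros n. rewrite S_INR, sum_n_Reals. reflexivity.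
Qed.

(** * The zeta side as a function of x, and the induction on m *)

Definition quarter_sum (Z : R -> R -> R) (k : nat) (x : R) : R :=
  odd_zeta_deriv Z (S k) (1 / 4 - x / (2 * PI)) + odd_zeta_deriv Z (S k) (1 / 4 + x / (2 * PI)).
Definition quarter_sum' (Z : R -> R -> R) (k : nat) (x : R) : R :=
  (odd_zeta_deriv' Z k (1 / 4 + x / (2 * PI)) - odd_zeta_deriv' Z k (1 / 4 - x / (2 * PI))) / (2 * PI).

Lemma quarter_range (x : R) : Rabs x < PI / 2 ->
  0 < 1 / 4 - x / (2 * PI) < 1 / 2 /\ 0 < 1 / 4 + x / (2 * PI) < 1 / 2.
Proof.
  intros Hx. pose proof PI_RGT_0. apply Rabs_def2 in Hx.
  assert (E : x = x / (2 * PI) * (2 * PI)) by (field; lra).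
  set (t := x / (2 * PI)) in *. split; split; nra.
Qed.

Lemma is_derive_reflect (f : R -> R) (c p x d : R) :
  is_derive f (c - x / p) d -> is_derive (fun t => f (c - t / p)) x (- (d / p)).
Proof.
  intros H. apply is_derive_eq with (- / p * d); [unfold Rdiv; ring|].
  apply (is_derive_comp f (fun t => c - t / p)); [exact H|].
  unfold Rdiv. auto_derive; [exact I|ring].
Qed.

Lemma is_derive_affine (f : R -> R) (c p x d : R) :
  is_derive f (c + x / p) d -> is_derive (fun t => f (c + t / p)) x (d / p).
Proof.
  intros H. apply is_derive_eq with (/ p * d); [unfold Rdiv; ring|].
  apply (is_derive_comp f (fun t => c + t / p)); [exact H|].
  unfold Rdiv. auto_derive; [exact I|ring].
Qed.

Lemma is_derive_quarter_sum (Z : R -> R -> R) (HZ : is_HurwitzZeta Z) (k : nat) (x : R) :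
  Rabs x < PI / 2 -> is_derive (quarter_sum Z k) x (quarter_sum' Z k x).
Proof.
  intros Hx. destruct (quarter_range x Hx) as [H1 H2].
  apply is_derive_eq with (- (odd_zeta_deriv' Z k (1 / 4 - x / (2 * PI)) / (2 * PI)) + odd_zeta_deriv' Z k (1 / 4 + x / (2 * PI)) / (2 * PI)).
  - unfold quarter_sum', Rdiv. ring.
  - apply (is_derive_plus (fun t => odd_zeta_deriv Z (S k) (1 / 4 - t / (2 * PI))) (fun t => odd_zeta_deriv Z (S k) (1 / 4 + t / (2 * PI)))).
    + apply is_derive_reflect, is_derive_odd_zeta_deriv; [exact HZ|lra].
    + apply is_derive_affine, is_derive_odd_zeta_deriv; [exact HZ|lra].
Qed.

Lemma is_derive_quarter_sum' (Z : R -> R -> R) (k : nat) (x d1 d2 : R) :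
  is_derive (odd_zeta_deriv' Z k) (1 / 4 - x / (2 * PI)) d1 ->
  is_derive (odd_zeta_deriv' Z k) (1 / 4 + x / (2 * PI)) d2 ->
  is_derive (quarter_sum' Z k) x ((d1 + d2) / (2 * PI) ^ 2).
Proof.
  intros H1 H2. pose proof PI_RGT_0.
  apply is_derive_eq with (/ (2 * PI) * (d2 / (2 * PI) - - (d1 / (2 * PI)))); [field; lra|].
  apply is_derive_ext with (fun t => / (2 * PI) * (odd_zeta_deriv' Z k (1 / 4 + t / (2 * PI)) - odd_zeta_deriv' Z k (1 / 4 - t / (2 * PI)))).
  { intros t. unfold quarter_sum', Rdiv. eqR. ring. }
  apply (is_derive_scal (fun t => odd_zeta_deriv' Z k (1 / 4 + t / (2 * PI)) - odd_zeta_deriv' Z k (1 / 4 - t / (2 * PI)))).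
  apply (is_derive_minus (fun t => odd_zeta_deriv' Z k (1 / 4 + t / (2 * PI))) (fun t => odd_zeta_deriv' Z k (1 / 4 - t / (2 * PI)))).
  - now apply is_derive_affine.
  - now apply is_derive_reflect.
Qed.

Lemma quarter_sum'_0 (Z : R -> R -> R) (k : nat) : quarter_sum' Z k 0 = 0.
Proof.
  unfold quarter_sum'. replace (0 / (2 * PI)) with 0 by (unfold Rdiv; ring).
  rewrite Rplus_0_r, Rminus_0_r. unfold Rdiv; ring.
Qed.

(** Over a common denominator the numerator is the sine of the sum of the angles, sin(PI/2) = 1, and
    the denominator is cos(2t)/2 by the product formula. *)
Lemma cot_quarter_sum (t : R) : Rabs t < PI / 4 ->
  cos (PI / 4 - t) / sin (PI / 4 - t) + cos (PI / 4 + t) / sin (PI / 4 + t) = 2 / cos (2 * t).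
Proof.
  intros Ht. pose proof PI_RGT_0. apply Rabs_def2 in Ht.
  assert (H1 : 0 < sin (PI / 4 - t)) by (apply sin_gt_0; lra).
  assert (H2 : 0 < sin (PI / 4 + t)) by (apply sin_gt_0; lra).
  assert (H3 : 0 < cos (2 * t)) by (apply cos_gt_0; lra).
  assert (E1 : sin (PI / 4 - t) * sin (PI / 4 + t) = cos (2 * t) / 2).
  { pose proof (cos_plus (PI / 4 - t) (PI / 4 + t)) as A. pose proof (cos_minus (PI / 4 - t) (PI / 4 + t)) as B.
    replace (PI / 4 - t + (PI / 4 + t)) with (PI / 2) in A by field. rewrite cos_PI2 in A.
    replace (PI / 4 - t - (PI / 4 + t)) with (- (2 * t)) in B by field. rewrite cos_neg in B. lra. }
  assert (E2 : cos (PI / 4 - t) * sin (PI / 4 + t) + cos (PI / 4 + t) * sin (PI / 4 - t) = 1).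
  { pose proof (sin_plus (PI / 4 - t) (PI / 4 + t)) as A.
    replace (PI / 4 - t + (PI / 4 + t)) with (PI / 2) in A by field. rewrite sin_PI2 in A. lra. }
  apply Rmult_eq_reg_r with (sin (PI / 4 - t) * sin (PI / 4 + t)); [|nra].
  rewrite E1 at 2. field_simplify; [|lra|lra]. lra.
Qed.

Definition zeta_factor (k : nat) : R :=
  (-1) ^ k * (2 * PI) ^ (2 * k + 1) / (2 * INR (fact (2 * k + 1))).

(** Explains the constant of the theorem: the two integers come from the recursion for [D_m''], the
    square of 2 PI from the chain rule in x/(2 PI), and the sign from differentiating a cosine
    twice. *)
Lemma zeta_factor_S (k : nat) :
  zeta_factor (S k) * (INR (2 * k + 3) * INR (2 * k + 2) / (2 * PI) ^ 2) = - zeta_factor k.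
Proof.
  unfold zeta_factor. pose proof PI_RGT_0.
  replace (2 * S k + 1)%nat with (S (S (2 * k + 1))) by lia.
  replace (2 * k + 3)%nat with (S (S (2 * k + 1))) by lia.
  replace (2 * k + 2)%nat with (S (2 * k + 1)) by lia.
  generalize (2 * k + 1)%nat. intros n.
  rewrite !fact_simpl, !mult_INR. simpl pow.
  field. repeat split; try lra; [apply INR_fact_neq_0|apply not_0_INR; lia|apply not_0_INR; lia].
Qed.

Definition defect (Z : R -> R -> R) (k : nat) (x : R) : R :=
  zeta_factor k * quarter_sum Z k x - osc_series k x.

Lemma cos_odd_half_pi (n : nat) : cos ((2 * INR n + 1) * (PI / 2)) = 0.
Proof.
  apply cos_eq_0_1. exists (Z.of_nat n). rewrite <- INR_IZR_INZ. field.
Qed.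

(** Along this sequence the parameters are a and 1/2 - a with a = 1/(n + 5) tending to 0; the shift
    by 5 keeps x inside the open interval. At 1/2 the function [odd_zeta_deriv] vanishes by
    antisymmetry, and the cosine series is handled by dominated convergence, each term vanishing at
    PI/2. *)
Lemma defect_boundary (Z : R -> R -> R) (HZ : is_HurwitzZeta Z) (k : nat) :
  is_lim_seq (fun n => defect Z k (PI / 2 - 2 * PI * / (INR n + 5))) 0.
Proof.
  pose proof PI_RGT_0. set (a := fun n => / (INR n + 5)).
  assert (La : is_lim_seq a 0) by apply is_lim_seq_inv_INR_plus.
  assert (Ha : forall n, 0 < a n) by (intros n; apply Rinv_0_lt_compat; pose proof (pos_INR n); lra).
  assert (L1 : is_lim_seq (fun n => odd_zeta_deriv Z (S k) (a n)) 0).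
  { apply (filterlim_comp _ _ _ a (odd_zeta_deriv Z (S k)) eventually (at_right 0) (locally 0)); [|now apply odd_zeta_deriv_lim_0].
    intros P HP. destruct (La (fun y => 0 < y -> P y) HP) as [N HN].
    exists N. intros n Hn. exact (HN n Hn (Ha n)). }
  assert (L2 : is_lim_seq (fun n => odd_zeta_deriv Z (S k) (1 / 2 - a n)) 0).
  { replace (Finite 0) with (Finite (odd_zeta_deriv Z (S k) (1 / 2))).
    - apply (is_lim_seq_continuous (odd_zeta_deriv Z (S k)) (fun n => 1 / 2 - a n) (1 / 2)).
      + apply continuity_pt_filterlim. apply (ex_derive_continuous (odd_zeta_deriv Z (S k))).
        eexists. apply is_derive_odd_zeta_deriv; [exact HZ|lra].
      + replace (Finite (1 / 2)) with (Finite (1 / 2 - 0)) by (f_equal; ring).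
        apply (is_lim_seq_minus' _ _ (1 / 2) 0); [apply is_lim_seq_const|exact La].
    - unfold odd_zeta_deriv. replace (1 - 1 / 2) with (1 / 2) by field. f_equal. ring. }
  assert (L3 : is_lim_seq (fun n => osc_series k (PI / 2 - 2 * PI * a n)) 0).
  { replace 0 with (Series (fun _ : nat => 0)) by apply is_series_unique, is_series_zero.
    apply (Series_dominated_convergence (fun n j => osc (S k) j (PI / 2 - 2 * PI * a n)) (fun _ => 0) (fun j => / (INR j + 1) ^ 2)).
    - intros j. replace (Finite 0) with (Finite (osc (S k) j (PI / 2))).
      + apply (is_lim_seq_continuous (osc (S k) j) (fun n => PI / 2 - 2 * PI * a n) (PI / 2)).
        * apply continuity_pt_filterlim. apply (ex_derive_continuous (osc (S k) j)).
          eexists. apply is_derive_osc.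
        * replace (Finite (PI / 2)) with (Finite (PI / 2 - 2 * PI * 0)) by (f_equal; ring).
          apply (is_lim_seq_minus' _ _ (PI / 2) (2 * PI * 0)); [apply is_lim_seq_const|].
          apply (is_lim_seq_scal_l a (2 * PI) 0), La.
      + unfold osc. rewrite cos_odd_half_pi. f_equal. unfold Rdiv. ring.
    - intros n j. apply osc_bound.
    - apply ex_series_inv_sqr. }
  apply is_lim_seq_ext with (fun n => zeta_factor k * (odd_zeta_deriv Z (S k) (a n) + odd_zeta_deriv Z (S k) (1 / 2 - a n)) -
     osc_series k (PI / 2 - 2 * PI * a n)).
  { intros n. unfold defect, quarter_sum. fold (a n).
    replace (1 / 4 - (PI / 2 - 2 * PI * a n) / (2 * PI)) with (a n) by (field; lra).
    replace (1 / 4 + (PI / 2 - 2 * PI * a n) / (2 * PI)) with (1 / 2 - a n) by (field; lra).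
    reflexivity. }
  replace (Finite 0) with (Finite (zeta_factor k * (0 + 0) - 0)) by (f_equal; ring).
  apply (is_lim_seq_minus' _ _ (zeta_factor k * (0 + 0)) 0); [|exact L3].
  apply (is_lim_seq_scal_l _ (zeta_factor k) (0 + 0)).
  now apply (is_lim_seq_plus' _ _ 0 0).
Qed.

Lemma defect_zero_of_constant (Z : R -> R -> R) (HZ : is_HurwitzZeta Z) (k : nat) :
  (forall x, Rabs x < PI / 2 -> defect Z k x = defect Z k 0) ->
  forall x, Rabs x < PI / 2 -> defect Z k x = 0.
Proof.
  intros Hc x Hx. rewrite (Hc x Hx). pose proof PI_RGT_0.
  pose proof (defect_boundary Z HZ k) as L.
  assert (L' : is_lim_seq (fun _ => defect Z k 0) 0).
  { apply is_lim_seq_ext with (2 := L). intros n. apply Hc.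
    pose proof (pos_INR n).
    assert (0 < / (INR n + 5) <= / 5).
    { split; [apply Rinv_0_lt_compat; lra|apply Rinv_le_contravar; lra]. }
    apply Rabs_def1; nra. }
  pose proof (is_lim_seq_unique _ _ L') as E. rewrite Lim_seq_const in E. now injection E.
Qed.

(** The approximants use averages of partial sums, because the twice differentiated series diverges.
    The cotangent identity and [zeta_factor 0] = PI make the second derivative of the zeta side
    -1/(2 cos x), and [cesaro_osum_0] bounds its distance to the averaged trigonometric side. *)
Lemma defect_0 (Z : R -> R -> R) (HZ : is_HurwitzZeta Z) (x : R) : Rabs x < PI / 2 -> defect Z 0 x = 0.
Proof.
  revert x. apply (defect_zero_of_constant Z HZ). pose proof PI_RGT_0 as Hpi.
  apply (limit_of_flattening (PI / 2) (defect Z 0)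
    (fun n x => zeta_factor 0 * quarter_sum Z 0 x - / (INR n + 1) * sum_n (fun N => osum 1 N x) n)
    (fun n x => zeta_factor 0 * quarter_sum' Z 0 x - / (INR n + 1) * sum_n (fun N => osum' 1 N x) n)
    (fun n x => - / (2 * cos x) - / (INR n + 1) * sum_n (fun N => - osum 0 N x) n)).
  - intros n x Hx.
    apply (is_derive_minus (fun x => zeta_factor 0 * quarter_sum Z 0 x)).
    + apply (is_derive_scal (quarter_sum Z 0)). now apply is_derive_quarter_sum.
    + apply (is_derive_scal (fun x => sum_n (fun N => osum 1 N x) n)).
      apply (is_derive_sum_n_R (osum 1)). intros N. apply is_derive_osum.
  - intros n x Hx. destruct (quarter_range x Hx) as [R1 R2].
    apply (is_derive_minus (fun x => zeta_factor 0 * quarter_sum' Z 0 x)).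
    + evar_last.
      * apply (is_derive_scal (quarter_sum' Z 0)).
        apply is_derive_quarter_sum'; apply (is_derive_odd_zeta_deriv'_0 Z HZ); lra.
      * assert (Ht : Rabs (x / 2) < PI / 4) by (apply Rabs_def2 in Hx; apply Rabs_def1; lra).
        pose proof (cot_quarter_sum (x / 2) Ht) as E.
        replace (PI * (1 / 4 - x / (2 * PI))) with (PI / 4 - x / 2) by (field; lra).
        replace (PI * (1 / 4 + x / (2 * PI))) with (PI / 4 + x / 2) by (field; lra).
        replace (2 * (x / 2)) with x in E by field.
        assert (Hc : 0 < cos x) by (apply Rabs_def2 in Hx; apply cos_gt_0; lra).
        match type of E with ?p + ?q = _ =>
          replace (- (PI * p) + - (PI * q)) with (- (PI * (p + q))) by ring end.
        rewrite E. unfold zeta_factor. simpl. field. lra.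
    + apply (is_derive_scal (fun x => sum_n (fun N => osum' 1 N x) n)).
      apply (is_derive_sum_n_R (osum' 1) (fun N => - osum 0 N x)). intros N. apply is_derive_osum'.
  - intros n. rewrite quarter_sum'_0, (sum_n_ext _ (fun _ => 0)) by (intros; apply osum'_0).
    rewrite sum_n_const. ring.
  - intros b Hb. exists (fun n => / (2 * cos b ^ 2) * / (INR n + 1)). split.
    + replace (Finite 0) with (Rbar_mult (/ (2 * cos b ^ 2)) 0) by (simpl; f_equal; ring).
      apply is_lim_seq_scal_l, is_lim_seq_inv_INR_plus.
    + intros n x Hx. rewrite sum_n_opp_R.
      eapply Rle_trans; [right|apply (cesaro_osum_0 b x n Hb Hx)].
      f_equal. unfold Rdiv. ring.
  - intros x Hx. unfold defect.
    apply (is_lim_seq_minus' _ _ (zeta_factor 0 * quarter_sum Z 0 x) (osc_series 0 x)); [apply is_lim_seq_const|].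
    apply is_lim_seq_ext with (fun n => sum_n (fun N => osum 1 N x) n / (INR n + 1)).
    { intros n. apply Rmult_comm. }
    apply is_lim_seq_cesaro, osum_lim.
Qed.

(** By the induction hypothesis the zeta side one level lower equals [osc_series k], so the second
    derivative of an approximant is, up to sign, a tail of that series, uniformly small by
    comparison with inverse squares. *)
Lemma defect_S (Z : R -> R -> R) (HZ : is_HurwitzZeta Z) (k : nat) :
  (forall x, Rabs x < PI / 2 -> defect Z k x = 0) ->
  forall x, Rabs x < PI / 2 -> defect Z (S k) x = 0.
Proof.
  intros IH. apply (defect_zero_of_constant Z HZ). pose proof PI_RGT_0 as Hpi.
  apply (limit_of_flattening (PI / 2) (defect Z (S k))
    (fun n x => zeta_factor (S k) * quarter_sum Z (S k) x - osum (S (S k)) n x)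
    (fun n x => zeta_factor (S k) * quarter_sum' Z (S k) x - osum' (S (S k)) n x)
    (fun n x => - zeta_factor k * quarter_sum Z k x - - osum (S k) n x)).
  - intros n x Hx. apply (is_derive_minus (fun x => zeta_factor (S k) * quarter_sum Z (S k) x)).
    + apply (is_derive_scal (quarter_sum Z (S k))). now apply is_derive_quarter_sum.
    + apply is_derive_osum.
  - intros n x Hx. destruct (quarter_range x Hx) as [R1 R2].
    apply (is_derive_minus (fun x => zeta_factor (S k) * quarter_sum' Z (S k) x)).
    + evar_last.
      * apply (is_derive_scal (quarter_sum' Z (S k))).
        apply is_derive_quarter_sum'; apply (is_derive_odd_zeta_deriv'_S Z HZ); lra.
      * rewrite <- zeta_factor_S. unfold quarter_sum, Rdiv. ring.
    + apply is_derive_osum'.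
  - intros n. rewrite quarter_sum'_0, osum'_0. ring.
  - intros b Hb. exists (fun n => Series (fun n => / (INR n + 1) ^ 2) - sum_n (fun n => / (INR n + 1) ^ 2) n). split.
    + set (s := Series (fun n => / (INR n + 1) ^ 2)).
      replace (Finite 0) with (Finite (s - s)) by (f_equal; ring).
      apply (is_lim_seq_minus' _ _ s s); [apply is_lim_seq_const|].
      apply (Series_correct (fun n => / (INR n + 1) ^ 2)), ex_series_inv_sqr.
    + intros n x Hx. specialize (IH x ltac:(lra)). unfold defect in IH.
      eapply Rle_trans; [right|apply (osum_uniform k n x)].
      rewrite <- Rabs_Ropp. f_equal. lra.
  - intros x Hx. unfold defect.
    apply (is_lim_seq_minus' _ _ (zeta_factor (S k) * quarter_sum Z (S k) x) (osc_series (S k) x));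
      [apply is_lim_seq_const|apply osum_lim].
Qed.

Lemma defect_eq_0 (Z : R -> R -> R) (HZ : is_HurwitzZeta Z) (k : nat) :
  forall x, Rabs x < PI / 2 -> defect Z k x = 0.
Proof.
  induction k as [|k IH]; [intros x; now apply defect_0|].
  now apply defect_S.
Qed.

Theorem mainTheorem8 (Z : R -> R -> R) (HZ : is_HurwitzZeta Z)
  (m : nat) (Hm : (1 <= m)%nat) (x : R) (Hx1 : - (PI / 2) < x) (Hx2 : x < PI / 2) :
  let dZ := fun a : R => Derive (fun s : R => Z s a) (1 - 2 * INR m) in
  is_series
    (fun n : nat => (-1) ^ n * cos ((2 * INR n + 1) * x) / (2 * INR n + 1) ^ (2 * m))
    ((-1) ^ (m - 1) * (2 * PI) ^ (2 * m - 1) / (2 * INR (fact (2 * m - 1))) *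
     (dZ (1/4 - x / (2 * PI)) - dZ (3/4 - x / (2 * PI))
      + dZ (1/4 + x / (2 * PI)) - dZ (3/4 + x / (2 * PI)))).
Proof.
  intros dZ'. destruct m as [|k]; [lia|].
  assert (H0 : defect Z k x = 0).
  { apply defect_eq_0; [exact HZ|now apply Rabs_def1]. }
  apply (is_series_eq (fun n => osc (S k) n x) _ (osc_series k x));
    [reflexivity| |exact (Series_correct _ (ex_series_osc k x))].
  unfold defect in H0. apply Rminus_diag_uniq in H0. rewrite <- H0.
  unfold zeta_factor, quarter_sum. set (t := x / (2 * PI)).
  change (odd_zeta_deriv Z (S k)) with (fun a => dZ' a - dZ' (1 - a)). cbv beta.
  replace (2 * S k - 1)%nat with (2 * k + 1)%nat by lia.
  replace (S k - 1)%nat with k by lia.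
  (* The reflection pairs the parameters crosswise, 1/4 - t with 3/4 + t, so the four derivatives
     agree with those of the statement only after reordering. *)
  replace (1 - (1 / 4 - t)) with (3 / 4 + t) by field.
  replace (1 - (1 / 4 + t)) with (3 / 4 - t) by field.
  ring.
Qed.
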